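(* Let $\lambda>0$, $f_c\in\mathbb{N}$, $n=2f_c+1$, $\mathbb{T}=\mathbb{R}/\mathbb{Z}$ and $\phi:\mathbb{T}\to\mathbb{R}^n$, $\phi(x)=\big(1,(\sqrt2\sin(2\pi\ell x))_{\ell=1}^{f_c},(\sqrt2\cos(2\pi\ell x))_{\ell=1}^{f_c}\big)$. Then the set $\mathcal{K}=\mathcal{H}\cup\mathcal{G}^+\cup\mathcal{G}^-\subseteq\mathbb{R}^n$ has Lebesgue measure zero.
   Context: For $p\in\mathbb{R}^n$, $(\Phi^*p)(x)=\langle\phi(x),p\rangle$, $x\in\mathbb{T}$. For a real signed Radon measure $\mathbf{m}$ on $\mathbb{T}$, $|\mathbf{m}|_{TV}=|\mathbf{m}|(\mathbb{T})$ and $\partial|\mathbf{m}|_{TV}=\{f\in C(\mathbb{T}):\|f\|_\infty\le1,\ \int f\,d\mathbf{m}=|\mathbf{m}|_{TV}\}$. For $\beta\in\mathbb{R}^m$, $\mathcal{E}=(x_j)_{j=1}^m\in\mathbb{T}^m$: $\mathbf{m}_{\beta,\mathcal{E}}=\sum_j\beta_j\delta_{x_j}$ and $\Phi_{\mathcal{E}}\in\mathbb{R}^{n\times m}$ has columns $\phi(x_j)$. $M^\dagger$ is the Moore–Penrose pseudoinverse, $M^*$ the transpose, $v_I$ the restriction of a vector to indices in $I$, $[m]=\{1,\dots,m\}$ and $[0]=\emptyset$; $\mathbb{N}=\{1,2,\dots\}$. $\mathrm{Bd}$ is the topological boundary in $\mathbb{R}^n$ and $\Pi_Y$ is the projection onto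 the $y$ variable. $$\mathcal{H}=\bigcup_{m=1}^{f_c}\bigcup\Big\{\mathrm{Bd}\big(\Pi_Y\mathcal{Q}_{(m,\sigma,I,\boldsymbol{\ell})}\big):\sigma\in\{-1,1\}^m,\ I\subseteq[m],\ \boldsymbol{\ell}\in\mathbb{N}^m,\ \sum_{i=1}^m\boldsymbol{\ell}_i\le n\Big\},$$ where $\mathcal{Q}_{(m,\sigma,I,\boldsymbol{\ell})}$ is the set of all $(y,\mathcal{E},\beta)\in\mathbb{R}^n\times\mathbb{T}^m\times\mathbb{R}^m$ such that, with $\mathcal{E}=(x_i)_{i=1}^m$, $M=\Phi_{\mathcal{E}}$ and $\eta=\frac1\lambda\Phi^*(y-\Phi_{\mathcal{E}}\beta)$, $$\eta\in\partial|\mathbf{m}_{\beta,\mathcal{E}}|_{TV},\quad\mathrm{rank}(M)=m,\quad\big(M^\dagger(y-(M^* )^\dagger\lambda\sigma)\big)_I=0_I,\quad\eta^{(2j)}(x_i)=0\ \ \forall j\in[\boldsymbol{\ell}_i-1],\ i\in[m].$$ With $\delta_1=(1,0,\dots,0)\in\mathbb{R}^n$, $$\mathcal{G}^{+}=\mathrm{Bd}\big(\Pi_Y\{(y,\beta,\mathcal{E})\in\mathbb{R}^n\times\mathbb{R}_{\ge0}^n\times\mathbb{T}^n:y-\Phi_{\mathcal{E}}\beta=\lambda\delta_1\}\big),$$ $$\mathcal{G}^{-}=\mathrm{Bd}\big(\Pi_Y\{(y,\beta,\mathcal{E})\in\mathbb{R}^n\times\mathbb{R}_{\le0}^n\times\mathbb{T}^n:y-\Phi_{\mathcal{E}}\beta=-\lambda\delta_1\}\big).$$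 *)

(* Defs.v *)
From HB Require Import structures.
From mathcomp Require Import all_boot all_order all_algebra.
From mathcomp Require Import all_classical all_reals all_analysis.

Set Implicit Arguments.
Unset Strict Implicit.
Unset Printing Implicit Defensive.

Import Order.TTheory GRing.Theory Num.Theory.
Import numFieldNormedType.Exports.

Local Open Scope classical_set_scope.
Local Open Scope quotient_scope.
Local Open Scope ring_scope.

Lemma eq_mod1_refl (R : realType) :
  reflexive (fun x y : R => x - y \is a Num.int).
Proof. by move=> x /=; rewrite subrr rpred0. Qed.

Lemma eq_mod1_sym (R : realType) :
  symmetric (fun x y : R => x - y \is a Num.int).
Proof. by move=> x y /=; rewrite -opprB rpredN. Qed.

Lemma eq_mod1_trans (R : realType) :
  transitive (fun x y : R => x - y \is a Num.int).
Proof.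
move=> y x z /= xy yz.
by rewrite -(subrK y x) -addrA rpredD.
Qed.

Definition eq_mod1 (R : realType) : equiv_rel R :=
  EquivRel (fun x y : R => x - y \is a Num.int)
    (@eq_mod1_refl R) (@eq_mod1_sym R) (@eq_mod1_trans R).

Definition torus (R : realType) : Type :=
  quotient_topology {eq_quot (eq_mod1 R)}.

HB.instance Definition _ (R : realType) := PointedTopological.on (torus R).
HB.instance Definition _ (R : realType) := Quotient.on (torus R).

Definition torus_pi (R : realType) (t : R) : torus R := (\pi_(torus R) t)%qT.

Lemma torus_openE (R : realType) (U : set (torus R)) :
  open U = open (@torus_pi R @^-1` U).
Proof. by []. Qed.

Lemma torus_pi_eqP (R : realType) (s t : R) :
  reflect (torus_pi s = torus_pi t) (s - t \is a Num.int).
Proof. exact: (@eqquotP _ _ {eq_quot (eq_mod1 R)} s t). Qed.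

Lemma torus_piK (R : realType) (x : torus R) : torus_pi (repr x) = x.
Proof. exact: reprK. Qed.

Definition borel_torus (R : realType) :=
  g_sigma_algebraType (@open (torus R)).

(* Every point [x] of the torus has the lift [repr x] in [R]; the k-th
   derivative of a function on the torus is that of its 1-periodic lift, and
   does not depend on the lift of [x] (lemma [torus_deriveE] below). *)
Definition torus_derive (R : realType) (k : nat) (f : torus R -> R)
    (x : torus R) : R :=
  derive1n k (f \o @torus_pi R) (repr x).

Lemma torus_deriveE (R : realType) (k : nat) (f : torus R -> R) (t : R) :
  torus_derive k f (torus_pi t) = derive1n k (f \o @torus_pi R) t.
Proof.
have trans c (g : R -> R) : derive1n k (g \o shift c) = derive1n k g \o shift c.
  elim: k => [//|k IH]; rewrite !derive1nS IH.
  apply/funext => u /=; rewrite /derive1 /=.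
  suff -> : (fun h => h^-1 *: (derive1n k g (h + u + c) - derive1n k g (u + c)))
    = (fun h => h^-1 *: (derive1n k g (h + (u + c)) - derive1n k g (u + c))) by [].
  by apply/funext => h; rewrite addrA.
have h : repr (torus_pi t) - t \is a Num.int.
  by apply/torus_pi_eqP; rewrite torus_piK.
have <- : (f \o @torus_pi R) \o shift (repr (torus_pi t) - t) = f \o @torus_pi R.
  apply/funext => u /=; congr f; apply/torus_pi_eqP.
  by rewrite /shift/= addrAC subrr add0r.
by rewrite trans /torus_derive /= addrC subrK.
Qed.

Definition phi_lift (R : realType) (fc : nat) (t : R) : 'cV[R]_((fc.*2).+1) :=
  \col_i (if (i == 0 :> nat)%N then 1
          else if (i <= fc)%N then Num.sqrt 2 * sin (2 * pi * i%:R * t)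
          else Num.sqrt 2 * cos (2 * pi * (i - fc)%N%:R * t)).

Definition phi (R : realType) (fc : nat) (x : torus R) :
    'cV[R]_((fc.*2).+1) :=
  phi_lift fc (repr x).

Lemma phiE (R : realType) (fc : nat) (t : R) :
  phi fc (torus_pi t) = phi_lift fc t.
Proof.
have : repr (torus_pi t) - t \is a Num.int.
  by apply/torus_pi_eqP; rewrite torus_piK.
move=> /intrP[z hz].
have {}hz : repr (torus_pi t) = t + z%:~R by rewrite -hz addrC subrK.
have per (g : R -> R) (a : R) : periodic g (pi *+ 2) ->
    forall w : int, g (a + pi *+ 2 * w%:~R) = g a.
  move=> pg [m|m]; first by rewrite -pmulrn mulr_natr (periodicn pg).
  rewrite NegzE mulrNz -pmulrn mulrN mulr_natr.
  by rewrite -[in RHS](subrK (pi *+ 2 *+ m.+1) a) (periodicn pg).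
apply/matrixP => i j; rewrite !mxE hz.
have e (l : nat) : 2 * pi * l%:R * (t + z%:~R)
    = 2 * pi * l%:R * t + pi *+ 2 * (l%:Z * z)%:~R :> R.
  by rewrite mulrDr intrM -[(l%:Z)%:~R]/(l%:R) -[pi *+ 2]mulr_natl !mulrA.
by rewrite !e (per _ _ (@sinD2pi R)) (per _ _ (@cosD2pi R)).
Qed.

Definition Phi_star (R : realType) (fc : nat) (p : 'cV[R]_((fc.*2).+1)) :
    torus R -> R :=
  fun x => \sum_i phi fc x i 0 * p i 0.

Definition Phi_mx (R : realType) (fc m : nat) (E : 'I_m -> torus R) :
    'M[R]_((fc.*2).+1, m) :=
  \matrix_(i, j) phi fc (E j) i 0.

Definition czero_torus (R : realType) : {charge set (borel_torus R) -> \bar R} :=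
  czero.

Definition cadd_torus (R : realType)
    (mu nu : {charge set (borel_torus R) -> \bar R}) :
    {charge set (borel_torus R) -> \bar R} :=
  cadd mu nu.

Definition wdirac (R : realType) (b : R) (x : torus R) :
    {charge set (borel_torus R) -> \bar R} :=
  cscale b (charge_of_finite_measure (@dirac _ (borel_torus R) x R)).

Definition discrete_charge (R : realType) (m : nat) (beta : 'cV[R]_m)
    (E : 'I_m -> torus R) : {charge set (borel_torus R) -> \bar R} :=
  \big[@cadd_torus R/czero_torus R]_(j < m) wdirac (beta j 0) (E j).

Lemma discrete_chargeE (R : realType) (m : nat) (beta : 'cV[R]_m)
    (E : 'I_m -> torus R) (A : set (borel_torus R)) :
  discrete_charge beta E A =
    (\sum_(j < m) (beta j 0)%:E * @dirac _ (borel_torus R) (E j) R A)%E.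
Proof.
rewrite /discrete_charge.
by apply: (big_ind2 (fun (mu : {charge set (borel_torus R) -> \bar R}) v =>
  mu A = v)) => // mu v nu w <- <-.
Qed.

(* The positive and negative part, the total variation and the integral of a
   charge, taken with respect to a chosen Hahn decomposition; none of them
   depends on the choice (see [Hahn_decomposition_uniq]). *)
Definition hahn_pos (R : realType) d (T : measurableType d)
    (mu : {charge set T -> \bar R}) : set T :=
  sval (cid (Hahn_decomposition mu)).

Definition hahn_neg (R : realType) d (T : measurableType d)
    (mu : {charge set T -> \bar R}) : set T :=
  sval (cid (svalP (cid (Hahn_decomposition mu)))).

Definition hahnP (R : realType) d (T : measurableType d)
    (mu : {charge set T -> \bar R}) :
    hahn_decomposition mu (hahn_pos mu) (hahn_neg mu) :=
  svalP (cid (svalP (cid (Hahn_decomposition mu)))).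

Definition tv_norm (R : realType) d (T : measurableType d)
    (mu : {charge set T -> \bar R}) : \bar R :=
  charge_variation (hahnP mu) setT.

Definition charge_integral (R : realType) d (T : measurableType d)
    (mu : {charge set T -> \bar R}) (f : T -> R) : \bar R :=
  (\int[jordan_pos (hahnP mu)]_x (f x)%:E
   - \int[jordan_neg (hahnP mu)]_x (f x)%:E)%E.

Definition sup_norm (R : realType) (T : Type) (f : T -> R) : \bar R :=
  ereal_sup (range (fun x => `|f x|%:E)).

Definition tv_subdiff (R : realType)
    (mu : {charge set (borel_torus R) -> \bar R}) : set (torus R -> R) :=
  [set f : torus R -> R | [/\ continuous f,
     (sup_norm f <= 1)%E & charge_integral mu f = tv_norm mu]].

(* The four Penrose equations; over the reals the conjugate transpose is the
   transpose. *)
Definition penrose (R : realType) (n m : nat) (M : 'M[R]_(n, m))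
    (P : 'M[R]_(m, n)) : Prop :=
  [/\ M *m P *m M = M, P *m M *m P = P,
      (M *m P)^T = M *m P & (P *m M)^T = P *m M].

Definition mp_pinv (R : realType) (n m : nat) (M : 'M[R]_(n, m)) :
    'M[R]_(m, n) :=
  xget 0 [set P | penrose M P].

Lemma row_free_gram_unit (R : realType) (n m : nat) (A : 'M[R]_(n, m)) :
  row_free A -> A *m A^T \in unitmx.
Proof.
move=> fA; rewrite -row_free_unit -kermx_eq0; apply/eqP/row_matrixP => i.
rewrite row0; set u := row i _.
have uK : u *m (A *m A^T) = 0.
  by apply/sub_kermxP; exact: row_sub.
have : (u *m A) *m (u *m A)^T = 0.
  by rewrite trmx_mul mulmxA -(mulmxA u) uK mul0mx.
move=> /matrixP/(_ 0 0); rewrite !mxE => /eqP.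
rewrite psumr_eq0; last by move=> j _; rewrite [X in _ * X]mxE -expr2 sqr_ge0.
move=> /allP s0; apply: (row_free_inj fA); rewrite mul0mx; apply/rowP => j.
have := s0 j (mem_index_enum _); rewrite /= [X in _ * X]mxE -expr2 sqrf_eq0 => /eqP ->.
by rewrite mxE.
Qed.

Lemma penrose_exists (R : realType) (n m : nat) (M : 'M[R]_(n, m)) :
  exists P, penrose M P.
Proof.
have : exists r (C : 'M[R]_(n, r)) (D : 'M[R]_(r, m)),
    [/\ C *m D = M, row_free D & row_free C^T].
  exists (\rank M), (col_base M), (row_base M); split.
  - exact: mulmx_base.
  - exact: row_base_free.
  - by rewrite /row_free mxrank_tr; exact: col_base_full.
case=> r [C] [D] [<- /row_free_gram_unit Du /row_free_gram_unit].
rewrite trmxK => Cu {M}.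
set G := invmx (D *m D^T); set K := invmx (C^T *m C).
have DG : D *m (D^T *m G) = 1%:M by rewrite mulmxA mulmxV.
have KC : K *m C^T *m C = 1%:M by rewrite -mulmxA mulVmx.
have GT : G^T = G by rewrite /G trmx_inv trmx_mul trmxK.
have KT : K^T = K by rewrite /K trmx_inv trmx_mul trmxK.
have MP : C *m D *m (D^T *m G *m (K *m C^T)) = C *m (K *m C^T).
  by rewrite -mulmxA (mulmxA D) DG mul1mx.
have PM : D^T *m G *m (K *m C^T) *m (C *m D) = D^T *m G *m D.
  by rewrite -[LHS]mulmxA (mulmxA (K *m C^T)) KC mul1mx.
exists (D^T *m G *m (K *m C^T)); split.
- by rewrite MP -mulmxA (mulmxA (K *m C^T)) KC mul1mx.
- by rewrite PM -mulmxA (mulmxA D) DG mul1mx.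
- by rewrite MP !trmx_mul trmxK KT mulmxA.
- by rewrite PM !trmx_mul trmxK GT mulmxA.
Qed.

Lemma mp_pinvP (R : realType) (n m : nat) (M : 'M[R]_(n, m)) :
  penrose M (mp_pinv M).
Proof. by have [P hP] := penrose_exists M; exact: (xgetI _ hP). Qed.

Lemma penrose_uniq (R : realType) (n m : nat) (M : 'M[R]_(n, m))
    (P Q : 'M[R]_(m, n)) : penrose M P -> penrose M Q -> P = Q.
Proof.
move=> [P1 P2 P3 P4] [Q1 Q2 Q3 Q4].
have QP1 : (M *m Q) *m (M *m P) = M *m P by rewrite mulmxA Q1.
have PQ1 : (M *m P) *m (M *m Q) = M *m Q by rewrite mulmxA P1.
have MPQ : M *m P = M *m Q by rewrite -P3 -QP1 trmx_mul P3 Q3 PQ1.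
have PQ2 : (P *m M) *m (Q *m M) = P *m M by rewrite -mulmxA (mulmxA M) Q1.
have QP2 : (Q *m M) *m (P *m M) = Q *m M by rewrite -mulmxA (mulmxA M) P1.
have PQM : P *m M = Q *m M by rewrite -P4 -PQ2 trmx_mul P4 Q4 QP2.
by rewrite -P2 -mulmxA MPQ mulmxA PQM Q2.
Qed.

Definition bd (T : topologicalType) (A : set T) : set T :=
  closure A `\` interior A.

(* Lebesgue outer measure on R^n: infimum of the total volumes of the countable
   covers by closed (possibly degenerate) boxes. A set is Lebesgue measurable of
   measure zero exactly when its outer measure is zero. *)
Definition box (R : realType) (n : nat) (a b : 'cV[R]_n) : set 'cV[R]_n :=
  [set x | forall i, a i 0 <= x i 0 <= b i 0].

Definition box_volume (R : realType) (n : nat) (a b : 'cV[R]_n) : R :=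
  \prod_i (b i 0 - a i 0).

Definition lebesgue_outer (R : realType) (n : nat) (A : set 'cV[R]_n) :
    \bar R :=
  ereal_inf [set v | exists a b : nat -> 'cV[R]_n,
    [/\ forall k i, a k i 0 <= b k i 0,
        A `<=` \bigcup_k box (a k) (b k)
      & v = (\sum_(0 <= k <oo) (box_volume (a k) (b k))%:E)%E]].

Definition lebesgue_null (R : realType) (n : nat) (A : set 'cV[R]_n) : Prop :=
  lebesgue_outer A = 0%E.

Definition eta (R : realType) (lam : R) (fc m : nat) (y : 'cV[R]_((fc.*2).+1))
    (E : 'I_m -> torus R) (beta : 'cV[R]_m) : torus R -> R :=
  fun x => lam^-1 * Phi_star (y - Phi_mx fc E *m beta) x.

Definition setQ (R : realType) (lam : R) (fc m : nat) (sigma : 'cV[R]_m)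
    (I : {set 'I_m}) (ell : 'I_m -> nat) :
    set ('cV[R]_((fc.*2).+1) * ('I_m -> torus R) * 'cV[R]_m) :=
  [set t | let: (y, E, beta) := t in
    let M := Phi_mx fc E in
    [/\ tv_subdiff (discrete_charge beta E) (eta lam y E beta),
        \rank M = m,
        forall i, i \in I ->
          (mp_pinv M *m (y - mp_pinv M^T *m (lam *: sigma))) i 0 = 0
      & forall (i : 'I_m) (j : nat), (1 <= j <= ell i - 1)%N ->
          torus_derive (2 * j)%N (eta lam y E beta) (E i) = 0]].

Definition setH (R : realType) (lam : R) (fc : nat) : set 'cV[R]_((fc.*2).+1) :=
  \bigcup_(m in [set m | (1 <= m <= fc)%N])
  \bigcup_(t in [set t : 'cV[R]_m * {set 'I_m} * ('I_m -> nat) |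
      [/\ forall i, t.1.1 i 0 = -1 \/ t.1.1 i 0 = 1,
          forall i, (1 <= t.2 i)%N
        & (\sum_i t.2 i <= (fc.*2).+1)%N]])
    bd [set q.1.1 | q in setQ lam t.1.1 t.1.2 t.2].

Arguments setH {R} lam fc _.

Definition setGpos (R : realType) (lam : R) (fc : nat) :
    set 'cV[R]_((fc.*2).+1) :=
  bd [set q.1.1 | q in
    [set q : 'cV[R]_((fc.*2).+1) * 'cV[R]_((fc.*2).+1)
             * ('I_((fc.*2).+1) -> torus R) |
      (forall i, 0 <= q.1.2 i 0) /\
      q.1.1 - Phi_mx fc q.2 *m q.1.2 = lam *: delta_mx 0 0]].

Arguments setGpos {R} lam fc _.

Definition setGneg (R : realType) (lam : R) (fc : nat) :
    set 'cV[R]_((fc.*2).+1) :=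
  bd [set q.1.1 | q in
    [set q : 'cV[R]_((fc.*2).+1) * 'cV[R]_((fc.*2).+1)
             * ('I_((fc.*2).+1) -> torus R) |
      (forall i, q.1.2 i 0 <= 0) /\
      q.1.1 - Phi_mx fc q.2 *m q.1.2 = - (lam *: delta_mx 0 0)]].

Arguments setGneg {R} lam fc _.

Definition setK (R : realType) (lam : R) (fc : nat) : set 'cV[R]_((fc.*2).+1) :=
  setH lam fc `|` setGpos lam fc `|` setGneg lam fc.

Arguments setK {R} lam fc _.

(* Main.v *)
(* By quantifier elimination over real closed fields, each of the projected
   sets is described by a quantifier-free formula in the coordinates of y: the
   points of the torus are replaced by points of the unit circle, the integral
   and the total variation of a discrete measure are finite sums, and the
   pseudoinverses are pinned down by the Penrose equations. Where none of the
   nonzero polynomials of the formula vanishes, their signs, hence the truth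
   value of the formula, are locally constant. So the boundary of a projected
   set lies in the zero set of one nonzero polynomial.

   Such a zero set has measure zero: on a fine grid of a cube, p takes small
   values at few points only, by induction on the number of variables. Either
   the leading coefficient of p in one variable is small, which is rare by
   induction, or the small values in that variable lie in few short intervals.
   Since p is Lipschitz, the zero set is covered by the few grid cells at whose
   corner p is small. *)
From HB Require Import structures.
From mathcomp Require Import all_boot all_order all_algebra.
From mathcomp Require Import all_classical all_reals all_analysis.
From mathcomp Require ordered_qelim qe_rcf.
From mathcomp Require Import measurable_realfun ring lra zify.
Require Import Defs.

Set Implicit Arguments.
Unset Strict Implicit.
Unset Printing Implicit Defensive.

Import Order.TTheory GRing.Theory Num.Theory.
Import numFieldNormedType.Exports.

Local Open Scope classical_set_scope.
Local Open Scope ring_scope.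

(** * Polynomials in several variables *)

Section IteratedPoly.
Variable R : idomainType.

(** Polynomials in [n] variables are iterated univariate ones: an induction on [n] peels off
    variable 0, the outermost indeterminate, and the coefficients involve the other variables. An
    [idomainType] at each level keeps products of nonzero polynomials nonzero. *)
Fixpoint ipoly (n : nat) : idomainType :=
  if n is n'.+1 then {poly ipoly n'} else R.

Fixpoint ieval (n : nat) (e : seq R) : {rmorphism ipoly n -> R} :=
  match n return {rmorphism ipoly n -> R} with
  | 0 => idfun
  | n'.+1 => horner_eval (head 0 e) \o map_poly (ieval n' (behead e))
  end.

Fixpoint iconst n (c : R) : ipoly n :=
  if n is n'.+1 then (iconst n' c)%:P else c.

Fixpoint ivar n (i : nat) : ipoly n :=
  if n is n'.+1 then (if i is i'.+1 then (ivar n' i')%:P else 'X) else 0.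

Lemma ievalS n e (p : {poly ipoly n}) :
  ieval n.+1 e p = (map_poly (ieval n (behead e)) p).[head 0 e].
Proof. by []. Qed.

Lemma ieval_const n e c : ieval n e (iconst n c) = c.
Proof.
by elim: n e => [//|n IH] e; rewrite ievalS /= map_polyC hornerC; exact: IH.
Qed.

Lemma ieval_var n e i : (i < n)%N -> ieval n e (ivar n i) = e`_i.
Proof.
elim: n e i => [//|n IH] e [|i] lin; rewrite ievalS /=.
  by rewrite map_polyX hornerX; case: e.
rewrite map_polyC hornerC -nth_behead; exact: IH.
Qed.
End IteratedPoly.


(** * Lipschitz bounds for polynomials on cubes *)

Section Lipschitz.
Variable R : realFieldType.

(** Lipschitz continuity for the sup norm on each cube. A sequence stands for a point padded with
    zeros, so all indices can be tested without fixing a dimension. *)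
Definition llip (F : seq R -> R) := forall L, 0 <= L ->
  exists2 C, 0 <= C & forall h e e', (forall i, `|e`_i| <= L) ->
    (forall i, `|e'`_i| <= L) -> (forall i, `|e`_i - e'`_i| <= h) ->
    `|F e - F e'| <= C * h.

Lemma llip_const c : llip (fun=> c).
Proof.
by move=> L L0; exists 0 => // h e e' _ _ _; rewrite subrr normr0 mul0r.
Qed.

Lemma llip_var i : llip (fun e => e`_i).
Proof. by move=> L L0; exists 1 => // h e e' _ _ h1; rewrite mul1r. Qed.

Lemma llip_behead F : llip F -> llip (F \o behead).
Proof.
move=> lF L L0; have [C C0 FC] := lF L L0; exists C => // h e e' eL e'L ee'.
by apply: FC => i; rewrite !nth_behead.
Qed.

Lemma llipD F G : llip F -> llip G -> llip (fun e => F e + G e).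
Proof.
move=> lF lG L L0; have [C C0 FC] := lF L L0; have [D D0 GD] := lG L L0.
exists (C + D) => [|h e e' eL e'L ee']; first exact: addr_ge0.
rewrite opprD addrACA mulrDl (le_trans (ler_normD _ _))// lerD//.
  exact: FC.
exact: GD.
Qed.

(** Comparison with [[::]], which represents the origin of every cube. *)
Lemma llip_bounded F L : llip F -> 0 <= L ->
  exists2 B, 0 <= B & forall e, (forall i, `|e`_i| <= L) -> `|F e| <= B.
Proof.
move=> lF L0; have [C C0 FC] := lF L L0.
exists (C * L + `|F [::]|) => [|e eL]; first by rewrite addr_ge0// mulr_ge0.
rewrite -[F e](subrK (F [::])) (le_trans (ler_normD _ _))// lerD2r.
by apply: FC => // i; rewrite nth_nil ?normr0// subr0.
Qed.

Lemma llipM F G : llip F -> llip G -> llip (fun e => F e * G e).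
Proof.
move=> lF lG L L0; have [C C0 FC] := lF L L0; have [D D0 GD] := lG L L0.
have [B B0 FB] := llip_bounded lF L0; have [A A0 GA] := llip_bounded lG L0.
exists (B * D + C * A) => [|h e e' eL e'L ee'].
  by rewrite addr_ge0// mulr_ge0.
have -> : F e * G e - F e' * G e' = F e * (G e - G e') + (F e - F e') * G e'.
  by rewrite mulrBr mulrBl addrA subrK.
rewrite (le_trans (ler_normD _ _))// !normrM mulrDl -(mulrA B) (mulrAC C) lerD//.
  by rewrite ler_pM// ?FB// GD.
by rewrite ler_pM// ?GA// FC.
Qed.

Lemma llip_ieval n (p : ipoly R n) : llip (fun e => ieval n e p).
Proof.
elim: n p => [|n IH] p; first exact: llip_const.
elim/poly_ind: (p : {poly ipoly R n}) => [|q c IHq].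
  suff -> : (fun e => ieval n.+1 e (0 : {poly ipoly R n})) = fun=> 0.
    exact: llip_const.
  by apply/funext => e; rewrite rmorph0.
suff -> : (fun e => ieval n.+1 e (q * 'X + c%:P : {poly ipoly R n})) =
    (fun e => ieval n.+1 e q * e`_0 + ((ieval n)^~ c \o behead) e).
  by apply: llipD; [exact: (llipM IHq (@llip_var 0))|exact: llip_behead].
apply/funext => e; rewrite !ievalS rmorphD rmorphM /= map_polyX map_polyC.
by rewrite hornerD hornerM hornerX hornerC nth0.
Qed.
End Lipschitz.

(** * Small values of a univariate polynomial *)

Section SmallValues.
Variable R : realFieldType.

(* Dividing [q - q(t0)] by ['X - t0], with [t0] a point where [q] is small,
   lowers the degree and keeps the leading coefficient. *)
Lemma small_values_poly (d : nat) (s a : R) (q : {poly R}) :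
  0 < s -> 0 < a -> (size q <= d.+1)%N -> a < `|q`_d| ->
  exists2 c : seq R, (size c <= d)%N &
    forall t, `|q.[t]| <= a * (s / 2) ^+ d -> exists2 u, u \in c & `|t - u| < s.
Proof.
move=> s0 a0; elim: d q => [|d IH] q.
  move=> /size1_polyC ->; rewrite coefC eqxx => aq; exists [::] => // t.
  by rewrite hornerC expr0 mulr1 leNgt aq.
move=> sq aq; set b := a * (s / 2) ^+ d.+1.
have b0 : 0 < b by rewrite mulr_gt0// exprn_gt0// divr_gt0.
have [[t0 qt0]|nq] := pselect (exists t, `|q.[t]| <= b); last first.
  by exists [::] => // t qt; exfalso; apply: nq; exists t.
have /factor_theorem[r Er] : root (q - q.[t0]%:P) t0.
  by rewrite rootE hornerD hornerN hornerC subrr.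
have qE : q = r * ('X - t0%:P) + q.[t0]%:P by rewrite -Er subrK.
have rs : (size r <= d.+1)%N.
  have [->|r0] := eqVneq r 0; first by rewrite size_poly0.
  have : (size (q - q.[t0]%:P)%R <= d.+2)%N.
    rewrite (leq_trans (size_polyD _ _))// geq_max sq size_polyN.
    by rewrite (leq_trans (size_polyC_leq1 _)).
  by rewrite Er size_Mmonic ?monicXsubC// size_XsubC addn2.
have [|c sc cP] := IH r rs.
  have <- : q`_d.+1 = r`_d; last exact: aq.
  rewrite qE coefD coefC addr0 mulrBr coefB coefMX coefMC /=.
  by rewrite [r`_d.+1]nth_default// mul0r subr0.
exists (t0 :: c) => // t qt.
have [tt0|st] := ltP `|t - t0| s; first by exists t0; rewrite ?mem_head.
have [|u uc tu] := cP t; last by exists u; rewrite // inE uc orbT.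
(* Both [q.[t]] and [q.[t0]] are at most [b] in absolute value. Dividing by [|t - t0| >= s] leaves
   [2 * b / s = a * (s / 2) ^+ d], the threshold for [r]; this is where the factor [s / 2] comes
   from. *)
have : `|r.[t]| * `|t - t0| <= b + b.
  rewrite -normrM; have -> : r.[t] * (t - t0) = q.[t] - q.[t0].
    by rewrite [in q.[t]]qE hornerD hornerM hornerXsubC hornerC addrK.
  by rewrite (le_trans (ler_normB _ _))// lerD.
move=> /(le_trans (ler_wpM2l (normr_ge0 _) st)).
rewrite -ler_pdivlMr// => /le_trans; apply.
by rewrite /b exprS; set x := _ ^+ d; rewrite le_eqVlt; apply/orP; left;
  apply/eqP; field; rewrite gt_eqF.
Qed.
End SmallValues.

(** * Counting the grid points where a polynomial is small *)

Section Grid.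

Fixpoint grid (n N : nat) : seq (seq nat) :=
  if n is n'.+1 then [seq k :: g | g <- grid n' N, k <- iota 0 N]
  else [:: [::]].

Lemma size_grid n N : size (grid n N) = (N ^ n)%N.
Proof. by elim: n => [//|n IH] /=;
  rewrite size_allpairs IH size_iota expnSr. Qed.

Lemma mem_grid n N g : size g = n -> all (fun k => k < N)%N g -> g \in grid n N.
Proof.
elim: n g => [|n IH] [|k g]//= [sg] /andP[kN gN].
by apply: (allpairs_f (fun g k => k :: g)); [exact: IH|rewrite mem_iota].
Qed.

(** The rows that satisfy [Q] are counted in full, and each of the others contributes at most
    [B]. *)
Lemma count_allpairs_le (S T U : Type) (f : S -> T -> U) (P : pred U)
    (Q : pred S) (s : seq S) (t : seq T) (B : nat) :
  (forall x, ~~ Q x -> count (fun y => P (f x y)) t <= B)%N ->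
  (count P [seq f x y | x <- s, y <- t] <= count Q s * size t + size s * B)%N.
Proof.
move=> PB; elim: s => [//|x s IH] /=.
rewrite count_cat count_map mulnDl mulSn addnACA leq_add//.
case: (boolP (Q x)) => [_|/PB]; last by rewrite mul0n add0n.
by rewrite mul1n (leq_trans (count_size _ _))// leq_addr.
Qed.

(** One solution [j] confines all the others to the [2 * w + 1] integers around it. *)
Lemma count_near_le (N w : nat) (P : pred nat) :
  (forall j k, P j -> P k -> k <= j + w)%N ->
  (count P (iota 0 N) <= w.*2.+1)%N.
Proof.
move=> Pw; have [/hasP[j _ Pj]|] := boolP (has P (iota 0 N)); last first.
  by rewrite has_count -leqNgt leqn0 => /eqP ->.
rewrite -size_filter -[leqRHS](size_iota (j - w)%N).
apply: uniq_leq_size; first by rewrite filter_uniq// iota_uniq.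
move=> k; rewrite mem_filter !mem_iota => /andP[Pk _].
by have := Pw _ _ Pj Pk; have := Pw _ _ Pk Pj; lia.
Qed.

Lemma count_has_le (T U : Type) (r : T -> U -> bool) (c : seq U) (B : nat)
    (P : pred T) (s : seq T) :
  (forall t, P t -> has (r t) c) -> (forall u, count (r^~ u) s <= B)%N ->
  (count P s <= size c * B)%N.
Proof.
move=> Pc rB; apply: (@leq_trans (count (fun t => has (r t) c) s)).
  exact: sub_count.
elim: c {P Pc} => [|u c IH] /=; first by rewrite count_pred0.
rewrite mulSn; apply: leq_trans (leq_add (rB u) IH).
by rewrite -count_predUI leq_addr.
Qed.

Variable R : realType.

Lemma archi_mul_ge (a eps : R) : 0 < eps ->
  exists N0, forall N, (N0 <= N)%N -> a <= eps * N%:R.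
Proof.
move=> e0; exists (Num.truncn (a / eps)).+1 => N N0N.
rewrite -ler_pdivrMl// mulrC (le_trans (ltW (truncnS_gt _)))//.
by rewrite ler_nat.
Qed.

Definition mesh (L : R) (N : nat) : R := 2 * L / N%:R.

Definition gridpt (L : R) (N : nat) (g : seq nat) : seq R :=
  [seq - L + k%:R * mesh L N | k <- g].

Lemma few_small_values n (p : ipoly R n) (L eps : R) :
  p != 0 -> 0 < L -> 0 < eps ->
  exists2 delta : R, 0 < delta & exists N0, forall N, (N0 <= N)%N -> (0 < N)%N ->
  (count (fun g => `|ieval n (gridpt L N g) p : R| <= delta) (grid n N))%:R
    <= eps * (N ^ n)%:R.
Proof.
move=> p0 L0; elim: n p p0 eps => [|n IH] p p0 eps e0.
  (* Without variables, [p] is a nonzero constant and exceeds half its absolute value, so the only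
     grid point is not counted. *)
  exists (`|p : R| / 2); first by rewrite divr_gt0// normr_gt0.
  exists 0%N => N _ _; rewrite (_ : count _ _ = 0%N) ?mulr_ge0 ?ltW//.
  apply/eqP; rewrite -leqn0 leqNgt -has_count has_seq1 -ltNge;
    change (`|p : R| / 2 < `|p : R|).
  by rewrite gtr_pMr ?normr_gt0//; lra.
pose P : {poly ipoly R n} := p; pose d := (size P).-1.
have a0 : lead_coef P != 0 by rewrite lead_coef_eq0.
have e2 : 0 < eps / 2 by rewrite divr_gt0.
have [dl dl0 [N0 N0P]] := IH _ a0 _ e2.
(* The choices of [q] and [N1] bound the two summands [2 * d * (N / q)] and [d] of [B] by
   [eps / 4 * N] each, which gives [BN] below. *)
have [q /andP[q0 qP]] : exists q, (0 < q)%N && (8 * d%:R <= eps * q%:R).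
  have [q qP] := archi_mul_ge (8 * d%:R) e0.
  by exists q.+1 => /=; exact: qP.
have [N1 N1P] := archi_mul_ge (4 * d%:R) e0.
pose s : R := L / q%:R.
have q0' : 0 < q%:R :> R by rewrite ltr0n.
have s0 : 0 < s by rewrite divr_gt0.
exists (dl * (s / 2) ^+ d); first by rewrite mulr_gt0// exprn_gt0// divr_gt0.
exists (maxn N0 N1) => N; rewrite geq_max => /andP[N0N N1N] Npos.
have N' : 0 < N%:R :> R by rewrite ltr0n.
pose B := (d * (N %/ q).*2.+1)%N.
pose Q g := `|ieval n (gridpt L N g) (lead_coef P) : R| <= dl.
have BP g : ~~ Q g -> (count (fun k =>
    (`|ieval n.+1 (gridpt L N (k :: g)) p| <= dl * (s / 2) ^+ d)%R) (iota 0 N)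
    <= B)%N.
  rewrite -ltNge => Qg; set P' := map_poly (ieval n (gridpt L N g)) P.
  have sP' : (size P' <= d.+1)%N.
    by rewrite (leq_trans (size_poly _ _))// leqSpred.
  have [|c sc cP] := small_values_poly s0 dl0 sP' _; first by rewrite coef_map.
  apply: (@leq_trans (size c * (N %/ q).*2.+1)%N);
    last by rewrite leq_mul2r sc orbT.
  apply: (@count_has_le _ _ (fun k u => (`|- L + k%:R * mesh L N - u| < s)%R)).
    by move=> k /cP[u uc ku]; apply/hasP; exists u.
  move=> u; apply: count_near_le => j k ju ku.
  (* Two grid values within [s] of the same [u] are less than [2 * L / q] apart. The mesh is
     [2 * L / N], so their indices differ by at most [N %/ q]. *)
  have kj : `|(k%:R - j%:R) * mesh L N| < s + s.
    have -> : (k%:R - j%:R) * mesh L N =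
      (- L + k%:R * mesh L N - u) - (- L + j%:R * mesh L N - u) by ring.
    by rewrite (le_lt_trans (ler_normB _ _))// ltrD.
  have : (k%:R - j%:R) * (2 * L / N%:R) < 2 * (L / q%:R).
    by rewrite (le_lt_trans (ler_norm _))// [ltRHS]mulr_natl mulr2n.
  have -> : (k%:R - j%:R) * (2 * L / N%:R) = 2 * L * ((k%:R - j%:R) / N%:R).
    by ring.
  rewrite mulrA -subr_gt0 -mulrBr pmulr_rgt0 ?mulr_gt0// subr_gt0.
  rewrite ltr_pdivrMr// mulrC ltr_pdivlMr// mulrBl => H.
  have {}H : ((k - j) * q < N)%N.
    have [kj'|jk] := leqP k j; first by rewrite (eqP kj') mul0n.
    by rewrite -(ltr_nat R) natrM natrB ?(ltnW jk)// mulrBl.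
  by rewrite -leq_subLR leq_divRL// ltnW.
have BN : B%:R <= eps / 2 * N%:R.
  have Nq : (N %/ q)%:R <= N%:R / q%:R :> R.
    by rewrite ler_pdivlMr// -natrM ler_nat leq_trunc_div.
  have := N1P N N1N.
  have : 8 * d%:R * (N%:R / q%:R) <= eps * N%:R.
    rewrite mulrA ler_pdivrMr// -[leRHS]mulrA [N%:R * _]mulrC mulrA.
    by rewrite ler_wpM2r// ler0n.
  have : d%:R * (N %/ q)%:R <= d%:R * (N%:R / q%:R) :> R by rewrite ler_wpM2l.
  rewrite /B natrM -[_.*2.+1]addn1 natrD -muln2 natrM.  lra.
(* The rows with a small leading coefficient number at most [eps / 2 * N ^ n] and have [N] points
   each. The other rows, at most [N ^ n], have at most [eps / 2 * N] small values each. *)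
have := @count_allpairs_le _ _ _ (fun g k => k :: g)
  (fun g => `|ieval n.+1 (gridpt L N g) p| <= dl * (s / 2) ^+ d) Q
  (grid n N) (iota 0 N) B BP; rewrite size_grid size_iota.
rewrite -(ler_nat R) => /le_trans; apply.
rewrite natrD natrM [(_ * B)%:R]natrM expnSr natrM.
have := N0P N N0N Npos; rewrite -/Q => /(ler_wpM2r (ltW N')) H.
have : (N ^ n)%:R * B%:R <= (N ^ n)%:R * (eps / 2 * N%:R) by rewrite ler_wpM2l.
lra.
Qed.
End Grid.

(** * Zero sets of polynomials are negligible *)

Section Negligible.
Variable R : realType.

(** The bound on all partial sums keeps the covering arguments within finite sums of reals; extended
    real series enter only in [small_covers_null]. *)
Definition small_covers n (A : set 'cV[R]_n) := forall eps : R, 0 < eps ->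
  exists a b : nat -> 'cV[R]_n, [/\ forall k i, a k i 0 <= b k i 0,
    A `<=` \bigcup_k box (a k) (b k) &
    forall N, \sum_(k < N) box_volume (a k) (b k) <= eps].

Lemma box_volume_ge0 n (a b : 'cV[R]_n) :
  (forall i, a i 0 <= b i 0) -> 0 <= box_volume a b.
Proof. by move=> ab; apply: prodr_ge0 => i _; rewrite subr_ge0. Qed.

Lemma small_covers_null n (A : set 'cV[R]_n) :
  small_covers A -> lebesgue_null A.
Proof.
move=> sA; apply/eqP; rewrite eq_le; apply/andP; split; last first.
  apply: le_ereal_inf_tmp => _ [a [b [ab _ ->]]].
  by apply: nneseries_ge0 => k _ _; rewrite lee_fin box_volume_ge0.
apply/lee_addgt0Pr => e e0; rewrite add0e.
have [a [b [ab Aab Nab]]] := sA e e0.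
apply: ge_ereal_inf; exists (\sum_(0 <= k <oo) (box_volume (a k) (b k))%:E)%E.
  by exists a, b.
apply: lime_le.
  by apply: is_cvg_nneseries => k _ _; rewrite lee_fin box_volume_ge0.
by apply: nearW => N; rewrite big_mkord sumEFin lee_fin.
Qed.

Lemma small_covers_sub n (A B : set 'cV[R]_n) :
  A `<=` B -> small_covers B -> small_covers A.
Proof.
move=> AB sB e e0; have [a [b [ab Bab Nab]]] := sB e e0.
by exists a, b; split => //; exact: subset_trans Bab.
Qed.

Lemma ler_sum_uniq_sub (T : eqType) (F : T -> R) (s t : seq T) :
  (forall x, 0 <= F x) -> uniq s -> {subset s <= t} ->
  \sum_(x <- s) F x <= \sum_(x <- t) F x.
Proof.
move=> F0; elim: s t => [|x s IH] t /=; first by rewrite big_nil sumr_ge0.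
move=> /andP[xs us] st.
have xt : x \in t by rewrite st// mem_head.
have pt := perm_to_rem xt.
rewrite (perm_big _ pt) !big_cons lerD2l IH// => y ys.
have := st y; rewrite inE ys orbT => /(_ isT); rewrite (perm_mem pt) inE.
by case: eqP => // yx; move: xs; rewrite -yx ys.
Qed.

(** The set [A k] receives the budget [e / 2 ^+ k.+1], and the covers are merged along a coding of
    pairs. An index that codes no pair gets the box reduced to the origin; its volume is zero
    because the dimension is positive, whereas an empty product would be 1. *)
Lemma small_covers_bigcup n (A : nat -> set 'cV[R]_n.+1) :
  (forall k, small_covers (A k)) -> small_covers (\bigcup_k A k).
Proof.
move=> sA e e0.
have ek k : 0 < e / 2 ^+ k.+1 by rewrite divr_gt0// exprn_gt0.
have /choice[a /choice[b abP]] : forall k, exists a, exists b, _ :=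
  fun k => sA k _ (ek k).
pose a' i := if pickle_inv i is Some kj then a kj.1 kj.2 else 0.
pose b' i := if pickle_inv i is Some kj then b kj.1 kj.2 else 0.
pose v kj := box_volume (a kj.1 kj.2) (b kj.1 kj.2).
have v0 kj : 0 <= v kj by have [ab _ _] := abP kj.1; exact: box_volume_ge0.
exists a', b'; split => [k i|x [k _ Akx]|N].
- rewrite /a' /b'; case: pickle_inv => [[k' j]|//].
  by have [ab _ _] := abP k'.
- have [_ /(_ x Akx)[j _ jx] _] := abP k.
  by exists (pickle (k, j)) => //; rewrite /a' /b' pickleK_inv.
(* The first [N] boxes correspond to a list [s] of distinct pairs, which is then enclosed in a
   rectangle [K] by [J]: the double sum over the rectangle is bounded row by row. *)
pose s : seq (nat * nat) := pmap pickle_inv (iota 0 N).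
have us : uniq s by rewrite (pmap_uniq (@pickle_invK _))// iota_uniq.
have -> : \sum_(i < N) box_volume (a' i) (b' i) = \sum_(kj <- s) v kj.
  rewrite -(big_mkord xpredT (fun i => box_volume (a' i) (b' i))) /index_iota subn0.
  rewrite /s; elim: (iota 0 N) => [|i r IH] /=; first by rewrite !big_nil.
  rewrite big_cons IH /a' /b'; case: pickle_inv => [kj|] /=.
    by rewrite big_cons.
  by rewrite /box_volume big_ord_recl subrr mul0r add0r.
pose K := (\max_(kj <- s) kj.1).+1; pose J := (\max_(kj <- s) kj.2).+1.
apply: (@le_trans _ _ (\sum_(kj <- [seq (k, j) | k <- iota 0 K, j <- iota 0 J]) v kj)).
  apply: ler_sum_uniq_sub => // -[k j] kjs.
  apply: (allpairs_f (fun k j => (k, j))).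
    rewrite mem_iota /= add0n ltnS.
    by rewrite (@leq_bigmax_seq _ s xpredT (fun kj => kj.1) (k, j)).
  rewrite mem_iota /= add0n ltnS.
  by rewrite (@leq_bigmax_seq _ s xpredT (fun kj => kj.2) (k, j)).
rewrite big_allpairs.
have : \sum_(k <- iota 0 K) e / 2 ^+ k.+1 <= e.
  have -> M : \sum_(k <- iota 0 M) e / 2 ^+ k.+1 = e - e / 2 ^+ M.
    rewrite -[iota 0 M]/(iota 0 M) -{1}(subn0 M) big_mkord.
    elim: M => [|M IH]; first by rewrite big_ord0 expr0 divr1 subrr.
    by rewrite big_ord_recr /= IH exprS; field; rewrite expf_neq0.
  by rewrite gerBl divr_ge0// ?exprn_ge0// ltW.
apply: le_trans; apply: ler_sum => k _.
have [_ _ /(_ J)] := abP k; apply: le_trans.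
by rewrite -(big_mkord xpredT (fun j => box_volume (a k j) (b k j))) /index_iota subn0.
Qed.

(** The list is continued by degenerate boxes at the origin, of volume zero in positive
    dimension. *)
Lemma finite_cover n (A : set 'cV[R]_n.+1) (s : seq ('cV[R]_n.+1 * 'cV[R]_n.+1))
    (eps : R) :
  (forall x, x \in s -> forall i, x.1 i 0 <= x.2 i 0) ->
  (forall y, A y -> exists2 x, x \in s & box x.1 x.2 y) ->
  \sum_(x <- s) box_volume x.1 x.2 <= eps ->
  exists a b : nat -> 'cV[R]_n.+1, [/\ forall k i, a k i 0 <= b k i 0,
    A `<=` \bigcup_k box (a k) (b k) &
    forall N, \sum_(k < N) box_volume (a k) (b k) <= eps].
Proof.
move=> s_le sA s_eps.
pose F (x : 'cV[R]_n.+1 * 'cV[R]_n.+1) := box_volume x.1 x.2.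
have F0 : F 0 = 0 by rewrite /F /box_volume big_ord_recl subrr mul0r.
exists (fun k => (nth 0 s k).1), (fun k => (nth 0 s k).2);
  split => [k i|y /sA[x xs xy]|N].
- have [ks|sk] := ltnP k (size s); last by rewrite nth_default.
  by apply: s_le; exact: mem_nth.
- by exists (index x s) => //; rewrite nth_index.
apply: le_trans s_eps; rewrite -/(F _).
elim: s s_le {sA} N => [|x s IH] s_le N.
  by rewrite big_nil big1// => k _; rewrite nth_nil -/(F _) F0.
have s_le' x' : x' \in s -> forall i, x'.1 i 0 <= x'.2 i 0.
  by move=> x's; apply: s_le; rewrite inE x's orbT.
case: N => [|N].
  rewrite big_ord0 big_seq sumr_ge0// => x' /s_le; exact: box_volume_ge0.
by rewrite big_ord_recl big_cons lerD2l /=; exact: IH.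
Qed.

Definition cvseq n (y : 'cV[R]_n) : seq R := [seq y i 0 | i <- enum 'I_n].

Lemma nth_cvseq n (y : 'cV[R]_n) (i : 'I_n) : (cvseq y)`_i = y i 0.
Proof. by rewrite (nth_map i) ?size_enum_ord// nth_ord_enum. Qed.

Lemma size_cvseq n (y : 'cV[R]_n) : size (cvseq y) = n.
Proof. by rewrite size_map size_enum_ord. Qed.

Lemma cvseq_dist n (y z : 'cV[R]_n) (d : R) : 0 <= d ->
  (forall i, `|y i 0 - z i 0| <= d) -> forall i, `|(cvseq y)`_i - (cvseq z)`_i| <= d.
Proof.
move=> d0 yz i; have [lin|ni] := ltnP i n.
  by have := yz (Ordinal lin); rewrite -!nth_cvseq.
by rewrite !nth_default ?size_cvseq// subrr normr0.
Qed.

Lemma small_covers_zero_bounded n (p : ipoly R n.+1) (L : R) : p != 0 -> 0 < L ->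
  small_covers [set y : 'cV[R]_n.+1 | (forall i, `|y i 0| <= L) /\
                                      ieval n.+1 (cvseq y) p = 0].
Proof.
move=> p0 L0 e e0.
(* At most [eps * N ^ n.+1] cells of volume [h ^+ n.+1] are kept. Since [h * N = 2 * L], their total
   volume is at most [eps * (2 * L) ^+ n.+1 = e]. *)
pose eps := e / (2 * L) ^+ n.+1.
have L2 : 0 < 2 * L by rewrite mulr_gt0.
have eps0 : 0 < eps by rewrite divr_gt0// exprn_gt0.
have [d d0 [N0 N0P]] := few_small_values p0 L0 eps0.
have [C C0 CP] := llip_ieval p (ltW L0).
have [N1 N1P] := archi_mul_ge (C * (2 * L)) d0.
pose N := (maxn N0 N1).+1.
have N'0 : 0 < N%:R :> R by rewrite ltr0n.
pose h := mesh L N.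
have h0 : 0 < h by rewrite divr_gt0.
have hN : h * N%:R = 2 * L by rewrite mulfVK// gt_eqF.
(* The polynomial varies by at most [C * h] between a point of a cell and its corner [lo g], so a
   zero in the cell forces a value at most [d] at that corner. *)
have Chd : C * h <= d.
  by rewrite /h /mesh mulrA ler_pdivrMr// N1P// /N; lia.
pose small g := `|ieval n.+1 (gridpt L N g) p : R| <= d.
pose lo g : 'cV[R]_n.+1 := \col_i (gridpt L N g)`_i.
pose hi g : 'cV[R]_n.+1 := \col_i ((gridpt L N g)`_i + h).
apply: (@finite_cover _ _ [seq (lo g, hi g) | g <- grid n.+1 N & small g]).
- by move=> _ /mapP[g _ ->] i; rewrite !mxE lerDl ltW.
- move=> y [yL py].
  (* The minimum matters on the face [y i 0 = L], where the truncation equals [N]: such a point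
     belongs to the last cell, of index [N.-1]. *)
  pose k (i : 'I_n.+1) := minn (Num.truncn ((y i 0 + L) / h)) N.-1.
  have kN i : (k i < N)%N by rewrite /k ltnS geq_minr.
  have ky i : - L + (k i)%:R * h <= y i 0 <= - L + (k i)%:R * h + h.
    have /andP[yL1 yL2] : - L <= y i 0 <= L by rewrite -ler_norml.
    have q0 : 0 <= (y i 0 + L) / h by rewrite divr_ge0 ?(ltW h0)//; lra.
    have /andP[k1 k2] := truncn_itv q0.
    move: k1 k2; rewrite ler_pdivlMr// ltr_pdivrMr// => k1 k2.
    rewrite /k; set t := Num.truncn _ in k1 k2 *.
    have [tN|Nt] := leqP t N.-1.
      by move: k2; rewrite -natr1 mulrDl mul1r; lra.
    have : N.-1%:R * h <= t%:R * h by rewrite ler_pM2r// ler_nat ltnW.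
    have : N.-1%:R * h + h = 2 * L by rewrite -hN -[N in RHS]prednK// -natr1;
      ring.
    by lra.
  pose g := [seq k i | i <- enum 'I_n.+1].
  have sg : size g = n.+1 by rewrite size_map size_enum_ord.
  have gi (i : 'I_n.+1) : (gridpt L N g)`_i = - L + (k i)%:R * h.
    rewrite (nth_map 0%N) ?sg//.
    by rewrite (@nth_map _ i _ 0%N k i (enum 'I_n.+1)) ?size_enum_ord// nth_ord_enum.
  exists (lo g, hi g); last by move=> i; rewrite !mxE gi.
  apply/mapP; exists g => //; rewrite mem_filter mem_grid ?andbT; first last.
  + by rewrite all_map; apply/allP => i _ /=.
  + exact: sg.
  have lgE : gridpt L N g = cvseq (lo g).
    apply: (@eq_from_nth _ 0); rewrite size_map sg ?size_cvseq// => i iN.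
    by rewrite -[i]/(val (Ordinal iN)) nth_cvseq mxE.
  rewrite /small lgE; apply: le_trans Chd.
  rewrite -[ieval _ _ _]subr0 -[0 in X in X <= _]py.
  have loL i : `|lo g i 0| <= L.
    rewrite mxE gi; have := ky i; have := yL i; rewrite !ler_norml.
    have : 0 <= (k i)%:R * h by rewrite mulr_ge0// ltW.
    have : (k i)%:R * h <= N.-1%:R * h by rewrite ler_pM2r// ler_nat -ltnS.
    have : N.-1%:R * h + h = 2 * L by rewrite -hN -[N in RHS]prednK// -natr1;
      ring.
    by lra.
  apply: CP => i.
  + have [lin|ni] := ltnP i n.+1; first by have := loL (Ordinal lin);
    rewrite -nth_cvseq.
    by rewrite nth_default ?size_cvseq// normr0 ltW.
  + have [lin|ni] := ltnP i n.+1; first by have := yL (Ordinal lin);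
    rewrite -nth_cvseq.
    by rewrite nth_default ?size_cvseq// normr0 ltW.
  + apply: cvseq_dist; first exact: ltW.
    by move=> j; rewrite mxE gi; have := ky j; rewrite ler_norml; lra.
rewrite big_map big_filter.
under eq_bigr => g _.
  rewrite (_ : box_volume _ _ = h ^+ n.+1); last first.
    rewrite /box_volume;
      under eq_bigr => i _ do rewrite !mxE addrAC subrr add0r.
    by rewrite prodr_const card_ord.
  over.
rewrite big_const_seq iter_addr addr0 -mulr_natr.
have N0N : (N0 <= N)%N by rewrite /N; lia.
have := N0P N N0N isT; rewrite -/small.
move=> /(ler_wpM2l (exprn_ge0 n.+1 (ltW h0)))/le_trans; apply.
by rewrite mulrCA natrX -exprMn hN /eps divfK// expf_neq0// gt_eqF.
Qed.

Lemma small_covers_zero n (p : ipoly R n.+1) : p != 0 ->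
  small_covers [set y : 'cV[R]_n.+1 | ieval n.+1 (cvseq y) p = 0].
Proof.
move=> p0; pose A (k : nat) := [set y : 'cV[R]_n.+1 |
  (forall i, `|y i 0| <= k.+1%:R) /\ ieval n.+1 (cvseq y) p = 0].
apply: (@small_covers_sub _ _ (\bigcup_k A k)); last first.
  by apply: small_covers_bigcup => k; exact: small_covers_zero_bounded.
move=> y yp; exists (\sum_i Num.truncn (`|y i 0|)%R)%N => //; split => // i.
rewrite ltW// (lt_le_trans (truncnS_gt _))// ler_nat ltnS.
by rewrite (bigD1 i)//= leq_addr.
Qed.
End Negligible.

(** * Semialgebraic sets *)

Module ord := ordered_qelim.ord.

Section Semialgebraic.
Variable R : realType.

(* [r] assigns to the coordinates of the ambient space the variables that
   stand for them in the formula. *)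
Definition semialg (I : Type) (P : (I -> R) -> Prop) := forall r : I -> nat,
  exists f : ord.formula R, forall e, ord.holds e f <-> P (fun i => e`_(r i)).

Definition polyfun (I : Type) (F : (I -> R) -> R) := forall r : I -> nat,
  exists t : GRing.term R, forall e, GRing.eval e t = F (fun i => e`_(r i)).

Section Closure.
Variable I : Type.
Implicit Types (F G : (I -> R) -> R) (P Q : (I -> R) -> Prop).

Lemma polyfun_const c : polyfun (fun _ : I -> R => c).
Proof. by move=> r; exists (GRing.Const c). Qed.

Lemma polyfun_var (i : I) : polyfun (fun u => u i).
Proof. by move=> r; exists (GRing.Var R (r i)). Qed.

Lemma polyfunD F G : polyfun F -> polyfun G -> polyfun (fun u => F u + G u).
Proof.
by move=> pF pG r; have [[s sF] [t tG]] := (pF r, pG r);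
  exists (GRing.Add s t) => e /=; rewrite sF tG.
Qed.

Lemma polyfunM F G : polyfun F -> polyfun G -> polyfun (fun u => F u * G u).
Proof.
by move=> pF pG r; have [[s sF] [t tG]] := (pF r, pG r);
  exists (GRing.Mul s t) => e /=; rewrite sF tG.
Qed.

Lemma polyfunN F : polyfun F -> polyfun (fun u => - F u).
Proof.
by move=> pF r; have [s sF] := pF r; exists (GRing.Opp s) => e /=; rewrite sF.
Qed.

Lemma polyfunB F G : polyfun F -> polyfun G -> polyfun (fun u => F u - G u).
Proof. by move=> pF pG; exact/polyfunD/polyfunN. Qed.

Lemma polyfun_sum (K : Type) (s : seq K) (A : pred K) (F : K -> (I -> R) -> R) :
  (forall k, polyfun (F k)) -> polyfun (fun u => \sum_(k <- s | A k) F k u).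
Proof.
move=> pF; elim: s => [|k s IH].
  by under eq_fun do rewrite big_nil; exact: polyfun_const.
under eq_fun do rewrite big_cons.
by case: (A k) => //=; exact: (polyfunD (pF k) IH).
Qed.

Lemma semialg_ext P Q : (forall u, P u <-> Q u) -> semialg P -> semialg Q.
Proof. by move=> PQ sP r; have [f fP] := sP r; exists f => e; rewrite fP. Qed.

Lemma semialg_const (A : Prop) : semialg (fun _ : I -> R => A).
Proof.
move=> r; have [a|na] := pselect A; first by exists (ord.Bool true).
by exists (ord.Bool false) => e /=; split.
Qed.

Lemma semialg_eq F G : polyfun F -> polyfun G -> semialg (fun u => F u = G u).
Proof.
by move=> pF pG r; have [[s sF] [t tG]] := (pF r, pG r);
  exists (ord.Equal s t) => e /=; rewrite sF tG.
Qed.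

Lemma semialg_le F G : polyfun F -> polyfun G -> semialg (fun u => F u <= G u).
Proof.
by move=> pF pG r; have [[s sF] [t tG]] := (pF r, pG r);
  exists (ord.Le s t) => e /=; rewrite sF tG.
Qed.

Lemma semialg_and P Q : semialg P -> semialg Q -> semialg (fun u => P u /\ Q u).
Proof.
by move=> sP sQ r; have [[f fP] [g gQ]] := (sP r, sQ r);
  exists (ord.And f g) => e /=; rewrite fP gQ.
Qed.

Lemma semialg_imp P Q : semialg P -> semialg Q -> semialg (fun u => P u -> Q u).
Proof.
by move=> sP sQ r; have [[f fP] [g gQ]] := (sP r, sQ r);
  exists (ord.Implies f g) => e /=; rewrite fP gQ.
Qed.

Lemma semialg_not P : semialg P -> semialg (fun u => ~ P u).
Proof.
by move=> sP r; have [f fP] := sP r; exists (ord.Not f) => e /=; rewrite fP.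
Qed.

Lemma semialg_forall_fin (K : finType) (P : K -> (I -> R) -> Prop) :
  (forall k, semialg (P k)) -> semialg (fun u => forall k, P k u).
Proof.
move=> sP; apply: (@semialg_ext (fun u => forall k, k \in enum K -> P k u)).
  by move=> u; split=> Pu k // ; apply: Pu; rewrite mem_enum.
elim: (enum K) => [|k s IH].
  by apply: semialg_ext (semialg_const True) => u; split.
apply: semialg_ext (semialg_and (sP k) IH) => u; split.
  by move=> [Pk Ps] j; rewrite inE => /predU1P[->//|]; exact: Ps.
by move=> Pu; split=> [|j js]; apply: Pu; rewrite inE ?eqxx// js orbT.
Qed.
End Closure.

(** * Quantification over finite families of reals *)

Lemma holds_exists_block (s : seq nat) (f : ord.formula R) (e : seq R) :
  ord.holds e (foldr ord.Exists f s) <->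
  exists2 e' : seq R, (forall k, k \notin s -> e'`_k = e`_k) & ord.holds e' f.
Proof.
elim: s e => [|k s IH] e /=; split.
- by move=> ef; exists e.
- by move=> [e' e'e]; apply: ord.eq_holds => i; rewrite e'e.
- move=> [x /IH[e' e'e e'f]]; exists e' => // j;
  rewrite inE negb_or => /andP[jk js].
  by rewrite e'e// nth_set_nth /= (negbTE jk).
- move=> [e' e'e e'f]; exists e'`_k; apply/IH; exists e' => // j js.
  rewrite nth_set_nth /=; case: eqP => [->//|/eqP jk].
  by rewrite e'e// inE negb_or jk.
Qed.

(** The family [v] is stored in fresh variables, from [N] to [N + #|J| - 1], above every variable
    that [r] assigns to [u]. Finiteness of [I] provides [N]. *)
Lemma semialg_exists (I J : finType) (P : (I -> R) -> (J -> R) -> Prop) :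
  semialg (fun w : I + J -> R => P (w \o inl) (w \o inr)) ->
  semialg (fun u => exists v, P u v).
Proof.
move=> sP r; pose N := (\max_i (r i)).+1.
have rN i : (r i < N)%N by rewrite ltnS leq_bigmax.
pose r' (x : I + J) := match x with inl i => r i | inr j => (N + enum_rank j)%N end.
have [f fP] := sP r'; exists (foldr ord.Exists f (iota N #|J|)) => e.
have inlE (e' : seq R) : (forall k, k \notin iota N #|J| -> e'`_k = e`_k) ->
    (fun x => e'`_(r' x)) \o inl = (fun i => e`_(r i)).
  move=> e'e; apply/funext => i /=; rewrite e'e// mem_iota negb_and -ltnNge.
  by rewrite rN.
rewrite holds_exists_block; split=> [[e' e'e /fP]|[v Pv]].
  by rewrite inlE// => Pe'; exists ((fun x => e'`_(r' x)) \o inr).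
(* The new environment is long enough to hold [v] and to retain all of [e]. Only the block that
   starts at [N] is overwritten. *)
pose M := maxn (N + #|J|) (size e).
pose e'_ k := if (k < N)%N then e`_k else
  oapp v e`_k (omap enum_val (insub (k - N)%N : option 'I_#|J|)).
pose e' := mkseq e'_ M.
have e'E k : (k < M)%N -> e'`_k = e'_ k.
  by move=> kM; rewrite nth_mkseq.
have e'e k : k \notin iota N #|J| -> e'`_k = e`_k.
  rewrite mem_iota negb_and -ltnNge -leqNgt => /orP kN.
  have [Mk|kM] := leqP M k.
    by rewrite !nth_default// ?size_mkseq//; move: Mk;
      rewrite geq_max => /andP[].
  rewrite e'E// /e'_; case: ltnP => // Nk; rewrite insubN//=.
  by rewrite -leqNgt leq_subRL//; case: kN => //; rewrite ltnNge Nk.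
exists e' => //; apply/fP; rewrite inlE//.
suff -> : (fun x => e'`_(r' x)) \o inr = v by [].
apply/funext => j /=; rewrite e'E /e'_; last first.
  by rewrite leq_max ltn_add2l ltn_ord.
rewrite ltnNge leq_addr /= addKn.
by rewrite (valK (enum_rank j)) /= enum_rankK.
Qed.

Lemma semialg_forall (I J : finType) (P : (I -> R) -> (J -> R) -> Prop) :
  semialg (fun w : I + J -> R => P (w \o inl) (w \o inr)) ->
  semialg (fun u => forall v, P u v).
Proof.
move=> /semialg_not sP.
have := semialg_not (@semialg_exists I J (fun u v => ~ P u v) sP).
apply: semialg_ext => u.
split=> [nP v|Pu [v nPv]]; first by apply: contrapT => nPv; apply: nP; exists v.
exact: (nPv (Pu v)).
Qed.

(** * Local constancy of quantifier-free formulas off a zero set *)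

Lemma term_ipoly n (t : GRing.term R) : GRing.rterm t ->
  exists p : ipoly R n, forall e, size e = n -> GRing.eval e t = ieval n e p.
Proof.
elim: t => //=.
- move=> i _; have [lin|ni] := ltnP i n.
    by exists (ivar R n i) => e _; rewrite ieval_var.
  (* A variable beyond the length of the environment reads the default value 0. *)
  by exists 0 => e se; rewrite rmorph0 nth_default// se.
- by move=> c _; exists (iconst n c) => e _; rewrite ieval_const.
- by move=> k _; exists k%:R => e _; rewrite rmorph_nat.
- move=> s IHs t IHt /andP[/IHs[p pE] /IHt[q qE]].
  by exists (p + q) => e se; rewrite rmorphD pE// qE.
- by move=> s IHs /IHs[p pE]; exists (- p) => e se; rewrite rmorphN pE.
- by move=> s IHs k /IHs[p pE]; exists (p *+ k) => e se; rewrite rmorphMn pE.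
- move=> s IHs t IHt /andP[/IHs[p pE] /IHt[q qE]].
  by exists (p * q) => e se; rewrite rmorphM pE// qE.
- by move=> s IHs k /IHs[p pE]; exists (p ^+ k) => e se; rewrite rmorphXn pE.
Qed.

Lemma ieval_near n (p : ipoly R n) (y : 'cV[R]_n) (e : R) : 0 < e ->
  \forall z \near y, `|ieval n (cvseq z) p - ieval n (cvseq y) p| < e.
Proof.
(* This cube contains all points within distance 1 of [y], whence the cap 1 in [d]. The denominator
   [C + 1] is positive even if [C] is zero. *)
move=> e0; pose L : R := \sum_i `|y i 0| + 1.
have L0 : 0 <= L by rewrite addr_ge0// sumr_ge0.
have [C C0 CP] := llip_ieval p L0.
pose d := Num.min 1 (e / (C + 1)).
have C1 : 0 < C + 1 by rewrite ltr_wpDl.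
have d0 : 0 < d by rewrite lt_min ltr01 divr_gt0.
have yL i : `|y i 0| + 1 <= L by rewrite lerD2r (bigD1 i)//= lerDl sumr_ge0.
apply: filterS (nbhsx_ballx y d d0) => z yz.
have zy i : `|z i 0 - y i 0| <= d.
  by rewrite distrC ltW//; have := yz.2 i 0 => /=; rewrite /ball.
have cvL (x : 'cV[R]_n) : (forall i, `|x i 0| <= L) -> forall i, `|(cvseq x)`_i| <= L.
  move=> xL i; have [lin|ni] := ltnP i n.
    by have := xL (Ordinal lin); rewrite -nth_cvseq.
  by rewrite nth_default ?size_cvseq// normr0.
apply: (@le_lt_trans _ _ (C * d)).
  apply: CP; last by apply: cvseq_dist => //; exact: ltW.
    apply: cvL => i; apply: le_trans (yL i).
    rewrite -[z i 0](subrK (y i 0)) addrC (le_trans (ler_normD _ _))// lerD2l.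
    by rewrite (le_trans (zy i))// ge_min lexx.
  by apply: cvL => i; apply: le_trans (yL i); rewrite lerDl.
have : C * d <= C * (e / (C + 1)) by rewrite ler_wpM2l// ge_min lexx orbT.
move=> /le_lt_trans; apply; rewrite mulrA ltr_pdivrMr// mulrC ltr_pM2l//.
by rewrite ltrDl.
Qed.

Lemma ieval_sign_near n (p : ipoly R n) (y : 'cV[R]_n) : ieval n (cvseq y) p != 0 ->
  \forall z \near y, Num.sg (ieval n (cvseq z) p) = Num.sg (ieval n (cvseq y) p).
Proof.
rewrite -normr_gt0 => /(ieval_near p y); apply: filterS => z.
set a := ieval _ _ _; set b := ieval _ _ _ => ab.
have [b0|b0|b0] := ltgtP b 0; last by move: ab; rewrite b0 normr0 normr_lt0.
  rewrite (ltr0_sg b0) ltr0_sg//; move: ab; rewrite ltr_norml (ltr0_norm b0);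
    lra.
rewrite (gtr0_sg b0) gtr0_sg//; move: ab; rewrite ltr_norml (gtr0_norm b0); lra.
Qed.

Definition locally_decided n (A : 'cV[R]_n -> bool) :=
  exists2 p : ipoly R n, p != 0 & forall y, ieval n (cvseq y) p != 0 ->
    \forall z \near y, A z = A y.

Lemma sign_atom_near n (s t : GRing.term R) (A : R -> bool) :
  GRing.rterm s -> GRing.rterm t ->
  (forall x y, Num.sg x = Num.sg y -> A x = A y) ->
  locally_decided (fun y : 'cV[R]_n =>
    A (GRing.eval (cvseq y) s - GRing.eval (cvseq y) t)).
Proof.
move=> /(term_ipoly n)[p pE] /(term_ipoly n)[q qE] Asg.
have E (y : 'cV[R]_n) : GRing.eval (cvseq y) s - GRing.eval (cvseq y) t =
    ieval n (cvseq y) (p - q).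
  by rewrite rmorphB pE ?qE ?size_cvseq.
have [pq0|pq0] := eqVneq (p - q) 0.
  (* If both terms define the same polynomial, the atom has a constant truth value and the
     polynomial 1, without zeros, serves. *)
  exists 1; first exact: oner_neq0.
  by move=> y _; apply: (@filterE _ (nbhs y) _) => z; rewrite !E pq0 !rmorph0.
exists (p - q) => // y /ieval_sign_near; apply: filterS => z zy.
by rewrite !E; exact: Asg.
Qed.

Lemma qf_near n (f : ord.formula R) : ord.qf_form f -> ord.rformula f ->
  locally_decided (fun y : 'cV[R]_n => ord.qf_eval (cvseq y) f).
Proof.
have binop (b : bool -> bool -> bool) (A B : 'cV[R]_n -> bool) :
    locally_decided A -> locally_decided B ->
    locally_decided (fun y => b (A y) (B y)).
  (* Off the zero set of [p * q] both operands are locally constant, hence so is any Boolean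
     combination of them. *)
  move=> [p p0 pA] [q q0 qB]; exists (p * q); first by rewrite mulf_neq0.
  move=> y; rewrite rmorphM mulf_eq0 negb_or => /andP[/pA yA /qB].
  by move: yA; apply: filterS2 => z -> ->.
elim: f => //=.
- move=> b _ _; exists 1; first exact: oner_neq0.
  by move=> y _; exact: (@filterE _ (nbhs y) _).
- move=> s t _ /andP[rs rt].
  have [|p p0 pP] := @sign_atom_near n s t (fun x => x == 0) rs rt.
    by move=> x y xy; rewrite -sgr_eq0 xy sgr_eq0.
  by exists p => // y /pP; apply: filterS => z; rewrite !subr_eq0.
- move=> s t _ /andP[rs rt].
  have [|p p0 pP] := @sign_atom_near n s t (fun x => x < 0) rs rt.
    by move=> x y xy; rewrite -sgr_lt0 xy sgr_lt0.
  by exists p => // y /pP; apply: filterS => z; rewrite !subr_lt0.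
- move=> s t _ /andP[rs rt].
  have [|p p0 pP] := @sign_atom_near n s t (fun x => x <= 0) rs rt.
    by move=> x y xy; rewrite -sgr_le0 xy sgr_le0.
  by exists p => // y /pP; apply: filterS => z; rewrite !subr_le0.
- by move=> f IHf g IHg /andP[qf qg] /andP[rf rg]; apply: (binop andb);
  [exact: IHf|exact: IHg].
- by move=> f IHf g IHg /andP[qf qg] /andP[rf rg]; apply: (binop orb);
  [exact: IHf|exact: IHg].
- by move=> f IHf g IHg /andP[qf qg] /andP[rf rg]; apply: (binop implb);
  [exact: IHf|exact: IHg].
- move=> f IHf qf rf; have [p p0 pP] := IHf qf rf; exists p => // y /pP.
  by apply: filterS => z ->.
Qed.

Lemma semialg_bd n (P : ('I_n.+1 -> R) -> Prop) : semialg P ->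
  small_covers (bd [set y : 'cV[R]_n.+1 | P (fun i => y i 0)]).
Proof.
move=> sP; have [f fP] := sP val.
pose wproj i bc := qe_rcf.qfr_to_formula (@qe_rcf.wproj R i bc).
pose g := ord.quantifier_elim wproj (ord.to_rform f).
have gP (y : 'cV[R]_n.+1) : P (fun i => y i 0) <-> ord.qf_eval (cvseq y) g.
  rewrite (_ : (fun i => y i 0) = (fun i : 'I_n.+1 => (cvseq y)`_i)).
    by rewrite -fP; exact: (rwP (qe_rcf.rcf_satP (cvseq y) f)).
  by apply/funext => i; rewrite nth_cvseq.
have /andP[gqf gr] : ord.qf_form g && ord.rformula g.
  by apply: ord.quantifier_elim_wf;
    [exact: qe_rcf.wf_QE_wproj|exact: ord.to_rform_rformula].
have [p p0 pP] := qf_near n.+1 gqf gr.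
apply: small_covers_sub (small_covers_zero p0) => y [yc yi] /=.
apply/eqP/negP => /negP/pP yz.
(* The truth value is constant near [y]: if true, [y] is an interior point; if false, [y] is outside
   the closure. A boundary point is neither. *)
have [/gP yg|yg] := boolP (ord.qf_eval (cvseq y) g).
  by apply: yi; move: yz; apply: filterS => z zy /=; apply/gP; rewrite zy;
    apply/gP.
by have [z [/gP zg zy]] := yc _ yz; move: yg; rewrite -zy zg.
Qed.
End Semialgebraic.

(** * Discrete charges *)

Lemma maxr0_parts (R : realDomainType) (a : R) :
  Num.max a 0 - Num.max (- a) 0 = a /\ Num.max a 0 + Num.max (- a) 0 = `|a|.
Proof.
have [a0|a0] := leP a 0.
  by rewrite (max_l (y := 0)) ?oppr_ge0// sub0r opprK add0r ler0_norm.
by rewrite (max_r (y := 0)) ?oppr_le0 ?(ltW a0)// subr0 addr0 gtr0_norm.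
Qed.

Section DiscreteCharge.
Context (R : realType) d (T : measurableType d) (m : nat).
Implicit Types (x : 'I_m -> T) (b : 'I_m -> R).

(** The measure is replaced by the finite sum of scaled Dirac measures with which it agrees on
    measurable sets. Nonnegative functions come first, then [f] is split into its positive and
    negative parts. *)
Lemma integral_discrete (mu : {measure set T -> \bar R}) x b (f : T -> R) :
  (forall j, 0 <= b j) -> measurable_fun setT f ->
  (forall A, measurable A -> mu A = (\sum_j (b j)%:E * \d_(x j) A)%E) ->
  (\int[mu]_y (f y)%:E)%E = (\sum_j b j * f (x j))%:E.
Proof.
move=> b0 mf muE.
(* A sum of measures is indexed by natural numbers; indices outside ['I_m] receive the zero
   measure. *)
pose m_ (k : nat) : {measure set T -> \bar R} :=
  if insub k is Some i then mscale (NngNum (b0 i)) (\d_(x i)) else mzero.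
have m_E (j : 'I_m) : m_ j = mscale (NngNum (b0 j)) (\d_(x j)).
  by rewrite /m_ valK.
have ge0_int (g : T -> R) : (forall y, 0 <= g y) -> measurable_fun setT g ->
    (\int[mu]_y (g y)%:E)%E = (\sum_j b j * g (x j))%:E.
  move=> g0 mg; rewrite (eq_measure_integral (msum m_ m)); last first.
    move=> A mA _; rewrite /= /msum muE//; apply: eq_bigr => j _.
    by rewrite m_E.
  have /measurable_EFinP mg' := mg.
  rewrite ge0_integral_measure_sum//; last by move=> y _; rewrite lee_fin.
  rewrite -sumEFin; apply: eq_bigr => j _; rewrite m_E.
  rewrite ge0_integral_mscale//; last by move=> y _; rewrite lee_fin.
  by rewrite integral_dirac// diracT mul1e.
rewrite integralE.
have posE y : ((fun y => (f y)%:E)^\+ y = (Num.max (f y) 0)%:E)%E.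
  by rewrite funeposE EFin_max.
have negE y : ((fun y => (f y)%:E)^\- y = (Num.max (- f y) 0)%:E)%E.
  by rewrite funenegE EFin_max.
under eq_integral do rewrite posE.
under [X in (_ - X)%E]eq_integral do rewrite negE.
rewrite !ge0_int.
- rewrite -EFinB; congr _%:E; rewrite -sumrB; apply: eq_bigr => j _.
  by rewrite -mulrBr (maxr0_parts _).1.
- by move=> y; rewrite le_max lexx orbT.
- by apply: measurable_maxr => //; exact: measurableT_comp.
- by move=> y; rewrite le_max lexx orbT.
- exact: measurable_maxr.
Qed.

Variables (mu : {charge set T -> \bar R}) (x : 'I_m -> T) (b : 'I_m -> R).
Variable F : 'I_m -> set T.
Hypothesis muE : forall A, mu A = (\sum_j (b j)%:E * \d_(x j) A)%E.
Hypothesis mF : forall j, measurable (F j).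
Hypothesis Fx : forall j k, F j (x k) <-> k = j.

(** The set [F j] isolates the atom [x j], so the sign of [b j] can be read off inside a Hahn
    set. *)
Let mu_pick j A : A (x j) -> mu (A `&` F j) = (b j)%:E.
Proof.
move=> Axj; rewrite muE (bigD1 j)//= big1 ?adde0.
  by rewrite diracE mem_set ?mule1//; split => //; apply/Fx.
move=> k kj; rewrite diracE memNset ?mule0// => -[_ /Fx jk].
by rewrite jk eqxx in kj.
Qed.

(** An atom in the positive Hahn set has a nonnegative weight, since [F j] cuts out a subset of
    measure [b j]. An atom outside it lies in the negative set, has a nonpositive weight and
    contributes zero to both sides. The result is thus the same for every Hahn decomposition. *)
Let jordan_pos_discrete A : measurable A ->
  jordan_pos (hahnP mu) A = (\sum_j (Num.max (b j) 0)%:E * \d_(x j) A)%E.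
Proof.
move=> mA; have [[mP posP] [mN negN] PN PN0] := hahnP mu.
rewrite jordan_posE cjordan_posE /crestr0 mem_set// /crestr/= muE.
apply: eq_bigr => j _; rewrite !diracE in_setI.
have [xP|nxP] := pselect (hahn_pos mu (x j)).
  rewrite (mem_set xP) andbT max_l// -lee_fin -(mu_pick xP).
  by apply: posP; [exact: measurableI|exact: subIsetl].
have xN : hahn_neg mu (x j).
  by have : setT (x j) by []; rewrite -PN => -[].
rewrite (memNset nxP) andbF mule0 max_r ?mul0e// -lee_fin -(mu_pick xN).
by apply: negN; [exact: measurableI|exact: subIsetl].
Qed.

Let jordan_neg_discrete A : measurable A ->
  jordan_neg (hahnP mu) A = (\sum_j (Num.max (- b j) 0)%:E * \d_(x j) A)%E.
Proof.
move=> mA; have [[mP posP] [mN negN] PN PN0] := hahnP mu.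
rewrite jordan_negE cjordan_negE /crestr0 mem_set// /crestr/= muE.
rewrite -sumeN; last by move=> i j _ _; rewrite !diracE; case: (_ \in _);
  case: (_ \in _).
apply: eq_bigr => j _; rewrite !diracE in_setI.
have [xN|nxN] := pselect (hahn_neg mu (x j)).
  rewrite (mem_set xN) andbT max_l ?EFinN ?mulNe//.
  rewrite -lee_fin EFinN leeNr oppe0 -(mu_pick xN).
  by apply: negN; [exact: measurableI|exact: subIsetl].
have xP : hahn_pos mu (x j).
  by have : setT (x j) by []; rewrite -PN => -[].
rewrite (memNset nxN) andbF mule0 oppe0 max_r ?mul0e//.
rewrite -lee_fin EFinN leeNl oppe0 -(mu_pick xP).
by apply: posP; [exact: measurableI|exact: subIsetl].
Qed.

Lemma charge_integral_discrete (f : T -> R) : measurable_fun setT f ->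
  charge_integral mu f = (\sum_j b j * f (x j))%:E.
Proof.
move=> mf; rewrite /charge_integral.
rewrite (integral_discrete _ mf jordan_pos_discrete); last first.
  by move=> j; rewrite le_max lexx orbT.
rewrite (integral_discrete _ mf jordan_neg_discrete); last first.
  by move=> j; rewrite le_max lexx orbT.
rewrite -EFinB; congr _%:E; rewrite -sumrB; apply: eq_bigr => j _.
by rewrite -mulrBl (maxr0_parts _).1.
Qed.

Lemma tv_norm_discrete : tv_norm mu = (\sum_j `|b j|)%:E.
Proof.
rewrite /tv_norm /charge_variation jordan_pos_discrete// jordan_neg_discrete//.
rewrite -big_split /= -sumEFin; apply: eq_bigr => j _.
rewrite diracT !mule1 -EFinD; congr _%:E.
exact: (maxr0_parts _).2.
Qed.
End DiscreteCharge.

(** * The torus and the unit circle *)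

Section Torus.
Variable R : realType.
Implicit Types (t c s : R) (fc : nat).

Lemma circle_param c s : c * c + s * s = 1 ->
  exists t, cos (2 * pi * t) = c /\ sin (2 * pi * t) = s.
Proof.
move=> cs1; have c1 : -1 <= c <= 1.
  rewrite -ler_norml -(ler_pXn2r (n := 2))// ?nnegrE// expr1n.
  by rewrite real_normK ?num_real// expr2 -cs1 lerDl -expr2 sqr_ge0.
have s2 : Num.sqrt (1 - c ^+ 2) = `|s|.
  by rewrite -sqrtr_sqr -cs1 !expr2 addrAC subrr add0r.
have K (u : R) : 2 * pi * (u / (2 * pi)) = u.
  by rewrite mulrC divfK// mulf_neq0// gt_eqF// pi_gt0.
have [s0|s0] := leP 0 s.
  exists (acos c / (2 * pi)); rewrite K acosK ?in_itv//= sin_acos//.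
  by rewrite s2 ger0_norm.
exists (- acos c / (2 * pi)); rewrite K cosN acosK ?in_itv//= sinN sin_acos//.
by rewrite s2 ltr0_norm// opprK.
Qed.

(** Real and imaginary parts of the [l]-th power of the complex number with real part [c] and
    imaginary part [s]. On the unit circle they are the cosine and sine of the multiple angle, as
    polynomials in [c] and [s]. *)
Fixpoint multiple_angle (l : nat) (c s : R) : R * R :=
  if l is l'.+1 then
    let p := multiple_angle l' c s in (p.1 * c - p.2 * s, p.2 * c + p.1 * s)
  else (1, 0).

Lemma multiple_angleE l t :
  multiple_angle l (cos t) (sin t) = (cos (l%:R * t), sin (l%:R * t)).
Proof.
elim: l => [|l IH]; first by rewrite mul0r cos0 sin0.
by rewrite /= IH /= -natr1 mulrDl mul1r cosD sinD [cos _ * sin _]mulrC.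
Qed.

Definition circle_phi fc c s (i : 'I_(fc.*2).+1) : R :=
  if (i == 0 :> nat)%N then 1
  else if (i <= fc)%N then Num.sqrt 2 * (multiple_angle i c s).2
  else Num.sqrt 2 * (multiple_angle (i - fc) c s).1.

Lemma phi_circle fc t i :
  phi fc (torus_pi t) i 0 = circle_phi (cos (2 * pi * t)) (sin (2 * pi * t)) i.
Proof.
rewrite phiE mxE /circle_phi !multiple_angleE /=.
by rewrite ![_%:R * (_ * t)]mulrCA !mulrA.
Qed.

Lemma polyfun_circle_phi (I : Type) fc (c s : (I -> R) -> R) i :
  polyfun c -> polyfun s -> polyfun (fun u => @circle_phi fc (c u) (s u) i).
Proof.
move=> pc ps.
have pm l : polyfun (fun u => (multiple_angle l (c u) (s u)).1) /\
            polyfun (fun u => (multiple_angle l (c u) (s u)).2).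
  elim: l => [|l [IH1 IH2]] /=; first by split; exact: polyfun_const.
  split; first exact: (polyfunB (polyfunM IH1 pc) (polyfunM IH2 ps)).
  exact: (polyfunD (polyfunM IH2 pc) (polyfunM IH1 ps)).
rewrite /circle_phi; case: (_ == 0%N); first exact: polyfun_const.
case: (i <= fc)%N; apply: (polyfunM (polyfun_const _)); first exact: (pm i).2.
exact: (pm (i - fc)%N).1.
Qed.

(** * Derivatives of the trigonometric coordinates *)

Definition angular_freq fc (i : 'I_(fc.*2).+1) : R :=
  2 * pi * (if (i <= fc)%N then val i else (i - fc)%N)%:R.

(** The derivative of coordinate [i] of [phi_lift] with the angular frequency factored out; zero for
    the constant coordinate. *)
Definition phi_conj fc (i : 'I_(fc.*2).+1) t : R :=
  if (i == 0 :> nat)%N then 0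
  else if (i <= fc)%N then Num.sqrt 2 * cos (2 * pi * i%:R * t)
  else - (Num.sqrt 2 * sin (2 * pi * (i - fc)%N%:R * t)).

Lemma is_derive_mulr (a t : R) : is_derive t 1 ( *%R a) a.
Proof. by apply: is_derive_eq; rewrite /GRing.scale/= mulr1. Qed.

Lemma is_derive_sin_mul (a t : R) :
  is_derive t 1 (fun u => sin (a * u)) (a * cos (a * t)).
Proof.
have -> : (fun u => sin (a * u)) = sin \o ( *%R a) by [].
by apply: (is_derive_eq (is_derive1_comp _ (is_derive_mulr a t)));
  rewrite mulrC.
Qed.

Lemma is_derive_cos_mul (a t : R) :
  is_derive t 1 (fun u => cos (a * u)) (- (a * sin (a * t))).
Proof.
have -> : (fun u => cos (a * u)) = cos \o ( *%R a) by [].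
apply: (is_derive_eq (is_derive1_comp _ (is_derive_mulr a t))).
by rewrite mulrC mulrN.
Qed.

Lemma is_derive_scale (f : R -> R) (a df t : R) :
  is_derive t 1 f df -> is_derive t 1 (fun u => a * f u) (a * df).
Proof. by move=> H; exact: (@is_deriveZ _ _ _ f a t 1 df H). Qed.

Lemma is_derive_phi_lift fc (i : 'I_(fc.*2).+1) t :
  is_derive t 1 (fun u => phi_lift fc u i 0) (angular_freq i * phi_conj i t).
Proof.
have -> : (fun u : R => phi_lift fc u i 0) = (fun u => if (i == 0 :> nat)%N then 1
    else if (i <= fc)%N then Num.sqrt 2 * sin (2 * pi * i%:R * u)
    else Num.sqrt 2 * cos (2 * pi * (i - fc)%N%:R * u)).
  by apply/funext => u; rewrite mxE.
rewrite /phi_conj /angular_freq; have [i0|i0] := eqVneq (val i) 0%N.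
  by rewrite mulr0; exact: is_derive_cst.
case: leqP => ifc.
  apply: (is_derive_eq (is_derive_scale _ (is_derive_sin_mul _ _))).
  by rewrite mulrCA.
apply: (is_derive_eq (is_derive_scale _ (is_derive_cos_mul _ _))).
by rewrite !mulrN mulrCA.
Qed.

Lemma is_derive_phi_conj fc (i : 'I_(fc.*2).+1) t :
  is_derive t 1 (phi_conj i) (- (angular_freq i * phi_lift fc t i 0)).
Proof.
rewrite mxE /angular_freq /phi_conj; have [i0|i0] := eqVneq (val i) 0%N.
  have -> : (i <= fc)%N by rewrite [nat_of_ord i]i0.
  by rewrite i0 mulr0n mulr0 mul0r oppr0; exact: is_derive_cst.
case: leqP => ifc.
  apply: (is_derive_eq (is_derive_scale _ (is_derive_cos_mul _ _))).
  by rewrite mulrN mulrCA.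
have -> : (fun u : R => - (Num.sqrt 2 * sin (2 * pi * (i - fc)%N%:R * u))) =
    (fun u => - Num.sqrt 2 * sin (2 * pi * (i - fc)%N%:R * u)).
  by apply/funext => u; rewrite mulNr.
apply: (is_derive_eq (is_derive_scale _ (is_derive_sin_mul _ _))).
by rewrite mulNr mulrCA.
Qed.

Lemma is_derive_lincomb n (f : 'I_n -> R -> R) (a df : 'I_n -> R) t :
  (forall i, is_derive t 1 (f i) (df i)) ->
  is_derive t 1 (fun u => \sum_i a i * f i u) (\sum_i a i * df i).
Proof.
move=> fdf; rewrite (_ : (fun u => _) = \sum_i (fun u => a i * f i u)).
  by apply: is_derive_sum => i; exact: is_derive_scale.
by apply/funext => u; rewrite fct_sumE.
Qed.

(** Each coordinate is an eigenfunction of the second derivative, with eigenvalue minus the squared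
    frequency. Derivatives of even order therefore remain linear combinations of the same
    coordinates, polynomial on the unit circle. *)
Lemma derive1n_phi_lift fc (a : 'I_(fc.*2).+1 -> R) k :
  derive1n (2 * k) (fun u => \sum_i a i * phi_lift fc u i 0) =
  (fun u => \sum_i a i * (- angular_freq i ^+ 2) ^+ k * phi_lift fc u i 0).
Proof.
have D1 (b : 'I_(fc.*2).+1 -> R) : derive1 (fun u => \sum_i b i * phi_lift fc u i 0) =
    (fun u => \sum_i (b i * angular_freq i) * phi_conj i u).
  apply/funext => u; rewrite derive1E.
  rewrite (@derive_val _ _ _ _ _ _ _
    (is_derive_lincomb b (fun i => is_derive_phi_lift i u))).
  by apply: eq_bigr => i _; rewrite mulrA.
have D2 (b : 'I_(fc.*2).+1 -> R) : derive1 (fun u => \sum_i b i * phi_conj i u) =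
    (fun u => \sum_i - (b i * angular_freq i) * phi_lift fc u i 0).
  apply/funext => u; rewrite derive1E.
  rewrite (@derive_val _ _ _ _ _ _ _
    (is_derive_lincomb b (fun i => is_derive_phi_conj i u))).
  by apply: eq_bigr => i _; rewrite mulrN mulrA mulNr.
elim: k => [|k IH].
  by apply/funext => u; apply: eq_bigr => i _; rewrite expr0 mulr1.
rewrite mulnS addnC addn2 !derive1nS IH D1 D2.
apply/funext => u; apply: eq_bigr => i _; rewrite [_ ^+ k.+1]exprS;
set w := _ ^+ k; set v := phi_lift _ _ _ _. ring.
Qed.

Lemma eta_lift (lam : R) fc m y (E : 'I_m -> torus R) beta t :
  eta (fc := fc) lam y E beta (torus_pi t) =
  \sum_i (lam^-1 * (y - Phi_mx fc E *m beta) i 0) * phi_lift fc t i 0.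
Proof.
rewrite /eta /Phi_star mulr_sumr; apply: eq_bigr => i _.
by rewrite phiE -mulrA; congr (_ * _); rewrite mulrC.
Qed.

Lemma torus_derive_eta (lam : R) fc m y (E : 'I_m -> torus R) beta t k :
  torus_derive (2 * k) (eta (fc := fc) lam y E beta) (torus_pi t) =
  \sum_i (lam^-1 * (y - Phi_mx fc E *m beta) i 0) * (- angular_freq i ^+ 2) ^+ k *
          phi_lift fc t i 0.
Proof.
rewrite torus_deriveE (_ : _ \o _ = fun u => \sum_i
  (lam^-1 * (y - Phi_mx fc E *m beta) i 0) * phi_lift fc u i 0).
  by rewrite derive1n_phi_lift.
by apply/funext => u /=; rewrite eta_lift.
Qed.

(** * Continuity and measurability on the torus *)

Lemma continuous_torus (f : torus R -> R) :
  continuous (f \o @torus_pi R) -> continuous f.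
Proof.
move=> /continuousP cf; apply/continuousP => A oA; rewrite torus_openE.
exact: cf.
Qed.

Lemma continuous_phi fc i : continuous (fun x : torus R => phi fc x i 0).
Proof.
apply: continuous_torus.
rewrite (_ : _ \o _ = fun u => phi_lift fc u i 0); last first.
  by apply/funext => u; rewrite -phiE.
move=> u; apply: differentiable_continuous; apply/derivable1_diffP.
by have [] := is_derive_phi_lift i u.
Qed.

Lemma continuous_eta (lam : R) fc m y (E : 'I_m -> torus R) beta :
  continuous (eta (fc := fc) lam y E beta).
Proof.
pose a i := lam^-1 * (y - Phi_mx fc E *m beta) i 0.
apply: continuous_torus.
rewrite (_ : _ \o _ = fun u => \sum_i a i * phi_lift fc u i 0); last first.
  by apply/funext => u /=; rewrite eta_lift.
move=> u; apply: differentiable_continuous; apply/derivable1_diffP.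
by have [] := is_derive_lincomb a (fun i => is_derive_phi_lift i u).
Qed.

Lemma continuous_borel_torus (f : torus R -> R) : continuous f ->
  measurable_fun setT (f : borel_torus R -> R).
Proof.
move=> /continuousP cf; apply: (measurability _ (RGenOpens.measurableE R)).
move=> _ [_ [a [b ->] <-]]; rewrite setTI; apply: sub_sigma_algebra.
exact/cf/interval_open.
Qed.

(** These fibres serve as the measurable sets that isolate the atoms of a discrete charge. *)
Lemma measurable_phi_fiber fc (x : torus R) :
  measurable ([set z | phi fc z = phi fc x] : set (borel_torus R)).
Proof.
rewrite (_ : [set z | _] =
  \bigcap_(i in [set: 'I_(fc.*2).+1]) [set z | phi fc z i 0 = phi fc x i 0]).
  apply: fin_bigcap_measurable => // i _.
  rewrite (_ : [set z | _] = (fun z => phi fc z i 0) @^-1` [set phi fc x i 0]) //.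
  rewrite -[X in measurable X]setTI.
  exact: (continuous_borel_torus (@continuous_phi fc i)).
apply/seteqP; split => [z /= zx i _ /=|z zx]; first by rewrite zx.
by apply/matrixP => i j; rewrite ord1; exact: zx.
Qed.
End Torus.

(** * Semialgebraic description of the projected sets *)

Section PolynomialMatrices.
Variables (R : realType) (I : Type).

Definition polymx m n (F : (I -> R) -> 'M[R]_(m, n)) :=
  forall i j, polyfun (fun u => F u i j).

Lemma polymx_const m n (A : 'M[R]_(m, n)) : polymx (fun=> A).
Proof. by move=> i j; exact: polyfun_const. Qed.

Lemma polymx_entries m n (F : 'I_m -> 'I_n -> (I -> R) -> R) :
  (forall i j, polyfun (F i j)) -> polymx (fun u => \matrix_(i, j) F i j u).
Proof. by move=> pF i j; under eq_fun do rewrite mxE; exact: pF. Qed.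

Lemma polymxM m n p (F : (I -> R) -> 'M[R]_(m, n)) (G : (I -> R) -> 'M[R]_(n, p)) :
  polymx F -> polymx G -> polymx (fun u => F u *m G u).
Proof.
move=> pF pG i j; under eq_fun do rewrite mxE.
exact: (polyfun_sum _ _ (fun k => polyfunM (pF i k) (pG k j))).
Qed.

Lemma polymxB m n (F G : (I -> R) -> 'M[R]_(m, n)) :
  polymx F -> polymx G -> polymx (fun u => F u - G u).
Proof.
move=> pF pG i j; under eq_fun do rewrite !mxE.
exact: (polyfunB (pF i j) (pG i j)).
Qed.

Lemma polymx_tr m n (F : (I -> R) -> 'M[R]_(m, n)) :
  polymx F -> polymx (fun u => (F u)^T).
Proof. by move=> pF i j; under eq_fun do rewrite mxE; exact: pF. Qed.

Lemma semialg_mxeq m n (F G : (I -> R) -> 'M[R]_(m, n)) :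
  polymx F -> polymx G -> semialg (fun u => F u = G u).
Proof.
move=> pF pG.
apply: (@semialg_ext _ _ (fun u => forall i j, F u i j = G u i j)).
  by move=> u; split=> [FG|-> //]; apply/matrixP.
apply: semialg_forall_fin => i; apply: semialg_forall_fin => j.
exact: semialg_eq.
Qed.

Lemma semialg_penrose m n (F : (I -> R) -> 'M[R]_(m, n)) (G : (I -> R) -> 'M[R]_(n, m)) :
  polymx F -> polymx G -> semialg (fun u => penrose (F u) (G u)).
Proof.
move=> pF pG; have pFG := polymxM pF pG; have pGF := polymxM pG pF.
apply: (@semialg_ext _ _ (fun u => (F u *m G u *m F u = F u /\ G u *m F u *m G u = G u) /\
    ((F u *m G u)^T = F u *m G u /\ (G u *m F u)^T = G u *m F u))).
  by move=> u; split=> [[[? ?] [? ?]]|[]].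
apply: semialg_and; apply: semialg_and; apply: semialg_mxeq => //.
- exact: polymxM.
- exact: polymxM.
- exact: polymx_tr.
- exact: polymx_tr.
Qed.
End PolynomialMatrices.

(** * Translation of the optimality conditions to the unit circle *)

Section Certificates.
Variables (R : realType) (lam : R) (fc : nat).
Local Notation n := (fc.*2).+1.
Implicit Type y : 'cV[R]_n.

Definition circle_mx m (c s : 'I_m -> R) : 'M[R]_(n, m) :=
  \matrix_(i, j) circle_phi (c j) (s j) i.

Definition circle_eta m y (c s : 'I_m -> R) (b : 'cV[R]_m) (c' s' : R) : R :=
  \sum_i lam^-1 * (y - circle_mx c s *m b) i 0 * circle_phi c' s' i.

(* The conditions defining [setQ], with the point [x] of the torus replaced by
   the point [(cos (2 pi x), sin (2 pi x))] of the unit circle. *)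
Definition circleQ m (sigma : 'cV[R]_m) (I : {set 'I_m}) (ell : 'I_m -> nat)
    y (c s : 'I_m -> R) (b : 'cV[R]_m) : Prop :=
  let M := circle_mx c s in
  [/\ forall v : bool -> R, v true * v true + v false * v false = 1 ->
        -1 <= circle_eta y c s b (v true) (v false) /\
        circle_eta y c s b (v true) (v false) <= 1,
      \sum_j b j 0 * circle_eta y c s b (c j) (s j) = \sum_j `|b j 0|,
      exists L : 'M[R]_(m, n), L *m M = 1%:M,
      exists (P : 'M[R]_(m, n)) (P' : 'M[R]_(n, m)),
        [/\ penrose M P, penrose M^T P' &
            forall i, i \in I -> (P *m (y - P' *m (lam *: sigma))) i 0 = 0]
    & forall (i : 'I_m) (j : 'I_(ell i)), (1 <= j <= ell i - 1)%N ->
        \sum_k lam^-1 * (y - M *m b) k 0 * (- angular_freq R k ^+ 2) ^+ j *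
               circle_phi (c i) (s i) k = 0].

Lemma circle_mx_Phi m (t : 'I_m -> R) : Phi_mx fc (fun j => torus_pi (t j)) =
  circle_mx (fun j => cos (2 * pi * t j)) (fun j => sin (2 * pi * t j)).
Proof. by apply/matrixP => i j; rewrite [LHS]mxE phi_circle mxE. Qed.

(** Injectivity makes the fibre of [phi] through each [E j] avoid the other atoms, so the integral
    and the total variation become finite sums. *)
Lemma discrete_tv_subdiff m (b : 'cV[R]_m) (E : 'I_m -> torus R) f :
  injective (phi fc \o E) -> continuous f ->
  charge_integral (discrete_charge b E) f = tv_norm (discrete_charge b E) <->
  \sum_j b j 0 * f (E j) = \sum_j `|b j 0|.
Proof.
move=> injE cf.
have muE := discrete_chargeE b E.
pose F j : set (borel_torus R) := [set z | phi fc z = phi fc (E j)].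
have mF j : measurable (F j) by exact: measurable_phi_fiber.
have FE j k : F j (E k) <-> k = j by split => [/injE//|->].
rewrite (charge_integral_discrete muE mF FE (continuous_borel_torus cf)).
by rewrite (tv_norm_discrete muE mF FE); split=> [[]|->].
Qed.

(** The supremum over the torus becomes a condition at all points of the circle, full column rank
    becomes a left inverse, and the uniqueness of Penrose inverses identifies [P] and [P'] with the
    pseudoinverses. *)
Lemma setQ_circle m (sigma : 'cV[R]_m) I ell y (t : 'I_m -> R) (b : 'cV[R]_m) :
  setQ lam sigma I ell (y, (fun j => torus_pi (t j)), b) <->
  circleQ sigma I ell y (fun j => cos (2 * pi * t j)) (fun j => sin (2 * pi * t j)) b.
Proof.
set c := (fun j => cos _); set s := (fun j => sin _);
  set E := (fun j => torus_pi _).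
have ME : Phi_mx fc E = circle_mx c s.
  by apply/matrixP => i j; rewrite [LHS]mxE phi_circle mxE.
have etaE u : eta lam y E b (torus_pi u) =
    circle_eta y c s b (cos (2 * pi * u)) (sin (2 * pi * u)).
  rewrite eta_lift /circle_eta ME; apply: eq_bigr => i _.
  by rewrite -phi_circle phiE.
have derE i k : torus_derive (2 * k) (eta lam y E b) (E i) =
    \sum_j lam^-1 * (y - circle_mx c s *m b) j 0 * (- angular_freq R j ^+ 2) ^+ k *
           circle_phi (c i) (s i) j.
  rewrite torus_derive_eta ME; apply: eq_bigr => j _.
  by rewrite -phi_circle phiE.
have rankE : \rank (Phi_mx fc E) = m <->
    exists L : 'M[R]_(m, n), L *m circle_mx c s = 1%:M.
  by rewrite -ME; split => [/eqP/row_fullP//|/row_fullP/eqP].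
(* If columns [j] and [k] were equal for distinct indices, the identity matrix would have equal
   entries 1 and 0 in row [j]. *)
have injE L : L *m circle_mx c s = 1%:M -> injective (phi fc \o E).
  move=> LM j k /= jk; have /matrixP/(_ j k) := LM.
  have <- : (L *m circle_mx c s) j j = (L *m circle_mx c s) j k.
    rewrite !mxE; apply: eq_bigr => i _;
      rewrite -ME [Phi_mx fc E i j]mxE [Phi_mx fc E i k]mxE.
    by rewrite jk.
  by rewrite LM !mxE eqxx; case: eqP => // _ /eqP; rewrite oner_eq0.
(* A point of the circle is a function on [bool], because quantified families need a finite index
   type. *)
have supE : (sup_norm (eta lam y E b) <= 1)%E <->
    forall v : bool -> R, v true * v true + v false * v false = 1 ->
        -1 <= circle_eta y c s b (v true) (v false) /\
        circle_eta y c s b (v true) (v false) <= 1.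
  split=> [s1 v /circle_param[u [<- <-]]|H].
    apply/andP; rewrite -etaE -ler_norml -lee_fin; apply: le_trans s1.
    by apply: ereal_sup_ubound; exists (torus_pi u).
  apply: ge_ereal_sup => _ [x _ <-];
    rewrite lee_fin -(torus_piK x) etaE ler_norml.
  pose v (d : bool) : R := if d then cos (2 * pi * repr x) else sin (2 * pi * repr x).
  by apply/andP; apply: (H v); rewrite /v -!expr2 cos2Dsin2.
split=> [[[cf s1 ci] rk pinv der]|[s1 ci [L LM] [P [P' [pP pP' pinv]]] der]].
- have [L LM] := rankE.1 rk; split.
  + exact/supE.
  + have := (discrete_tv_subdiff b (injE L LM) cf).1 ci.
    by under eq_bigr do rewrite etaE.
  + by exists L.
  + exists (mp_pinv (Phi_mx fc E)), (mp_pinv (Phi_mx fc E)^T); rewrite -ME.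
    by split => //; exact: mp_pinvP.
  + by move=> i j jl; rewrite -derE; exact: der.
- have cf : continuous (eta lam y E b) by exact: continuous_eta.
  split.
  + split => //; first exact/supE.
    apply/(discrete_tv_subdiff b (injE L LM) cf).
    by under eq_bigr do rewrite etaE.
  + by apply/rankE; exists L.
  + rewrite ME => i iI.
    rewrite (penrose_uniq (mp_pinvP (circle_mx c s)) pP).
    by rewrite (penrose_uniq (mp_pinvP (circle_mx c s)^T) pP') pinv.
  + move=> i j jl; rewrite derE.
    (* The orders from 1 to [ell i - 1] all lie in ['I_(ell i)], so the finite conjunction over that
       type captures every derivative condition. *)
    have jli : (j < ell i)%N by case/andP: jl; case: (ell i) => [|l]; lia.
    exact: (der i (Ordinal jli)).
Qed.
End Certificates.

(** * Negligible boundaries of the projected sets *)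

Section Boundaries.
Variables (R : realType) (lam : R) (fc : nat).
Local Notation n := (fc.*2).+1.
Implicit Type y : 'cV[R]_n.

(** Unknown vectors and matrices are families of reals over a finite type, the form that
    [semialg_exists] binds; [colv] and [mxv] turn them back into matrices. *)
Definition colv (k : nat) (v : 'I_k -> R) : 'cV[R]_k := \matrix_(i, j) v i.
Definition mxv (k l : nat) (v : 'I_k * 'I_l -> R) : 'M[R]_(k, l) :=
  \matrix_(i, j) v (i, j).

Lemma colvK k (b : 'cV[R]_k) : colv (fun i => b i 0) = b.
Proof. by apply/matrixP => i j; rewrite mxE ord1. Qed.

Lemma mxvK k l (A : 'M[R]_(k, l)) : mxv (fun ij => A ij.1 ij.2) = A.
Proof. by apply/matrixP => i j; rewrite mxE. Qed.

Lemma polymx_circle (J : Type) m (c s : 'I_m -> (J -> R) -> R) :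
  (forall j, polyfun (c j)) -> (forall j, polyfun (s j)) ->
  polymx (fun u => circle_mx fc (fun j => c j u) (fun j => s j u)).
Proof. by move=> pc ps; apply: polymx_entries => i j;
  exact: polyfun_circle_phi. Qed.

Lemma polymx_colv (J : Type) k (v : 'I_k -> (J -> R) -> R) :
  (forall i, polyfun (v i)) -> polymx (fun u => colv (fun i => v i u)).
Proof. by move=> pv; exact: (polymx_entries (fun i _ => pv i)). Qed.

Lemma polymx_mxv (J : Type) k l (v : 'I_k * 'I_l -> (J -> R) -> R) :
  (forall i, polyfun (v i)) -> polymx (fun u => mxv (fun i => v i u)).
Proof. by move=> pv; exact: (polymx_entries (fun i j => pv (i, j))). Qed.

(* The unknown vector [a] is forced to be the vector of the [`|b j|], which
   makes the sum of absolute values polynomial. *)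
Definition circleQ_ex m (sigma : 'cV[R]_m) (I : {set 'I_m}) (ell : 'I_m -> nat)
    (u : 'I_n -> R) : Prop :=
  exists c s b a : 'I_m -> R,
  (forall j, c j * c j + s j * s j = 1) /\
  (forall j, 0 <= a j /\ a j * a j = b j * b j) /\
  let y := colv u in let M := circle_mx fc c s in
  (forall v : bool -> R, v true * v true + v false * v false = 1 ->
    -1 <= circle_eta lam y c s (colv b) (v true) (v false) /\
    circle_eta lam y c s (colv b) (v true) (v false) <= 1) /\
  \sum_j b j * circle_eta lam y c s (colv b) (c j) (s j) = \sum_j a j /\
  (exists L, mxv L *m M = 1%:M) /\
  (exists P P', (penrose M (mxv P) /\ penrose M^T (mxv P')) /\
     forall i, i \in I -> (mxv P *m (y - mxv P' *m (lam *: sigma))) i 0 = 0) /\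
  forall (i : 'I_m) (j : 'I_(ell i)), (1 <= j <= ell i - 1)%N ->
    \sum_k lam^-1 * (y - M *m colv b) k 0 * (- angular_freq R k ^+ 2) ^+ j *
           circle_phi (c i) (s i) k = 0.

Lemma setQ_circleQ_ex m (sigma : 'cV[R]_m) I ell y :
  (exists2 q, setQ lam sigma I ell q & q.1.1 = y) <->
  circleQ_ex sigma I ell (fun i => y i 0).
Proof.
split=> [[[[y' E] b] /= + <-]|].
- rewrite (_ : E = fun j => torus_pi (repr (E j))); last first.
    by apply/funext => j; rewrite torus_piK.
  move=> /setQ_circle[s1 ci [L LM] [P [P' [pP pP' pinv]]] der].
  exists (fun j => cos (2 * pi * repr (E j))), (fun j => sin (2 * pi * repr (E j))).
  exists (fun j => b j 0), (fun j => `|b j 0|); rewrite !colvK.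
  split; first by move=> j; rewrite -!expr2 cos2Dsin2.
  split; first by move=> j;
    rewrite normr_ge0 -normrM -!expr2 ger0_norm ?sqr_ge0.
  split => //; split => //; split; first by exists (fun ij => L ij.1 ij.2);
    rewrite mxvK.
  split=> //; exists (fun ij => P ij.1 ij.2), (fun ij => P' ij.1 ij.2).
  by rewrite !mxvK.
- move=> [c [s [b [a [cs [ab]]]]]] /=; rewrite colvK.
  move=> [s1 [ci [[L LM] [[P [P' [[pP pP'] pinv]]] der]]]].
  have /choice[t tP] : forall j, exists t,
      cos (2 * pi * t) = c j /\ sin (2 * pi * t) = s j.
    by move=> j; exact: circle_param.
  have cE : c = (fun j => cos (2 * pi * t j)) by apply/funext => j;
    have [] := tP j.
  have sE : s = (fun j => sin (2 * pi * t j)) by apply/funext => j;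
    have [] := tP j.
  exists (y, (fun j => torus_pi (t j)), colv b) => //.
  apply/setQ_circle; rewrite -cE -sE; split => //.
  + under eq_bigr do rewrite mxE.
    rewrite ci; apply: eq_bigr => j _; rewrite mxE.
    have [a0 aa] := ab j; rewrite -(ger0_norm a0).
    by apply/eqP; rewrite -(eqrXn2 (n := 2))// -!normrX !expr2 aa.
  + by exists (mxv L).
  + by exists (mxv P), (mxv P').
Qed.

Lemma polymx_residual (J : Type) m (y : (J -> R) -> 'cV[R]_n)
    (c s : 'I_m -> (J -> R) -> R) (b : (J -> R) -> 'cV[R]_m) :
  polymx y -> (forall j, polyfun (c j)) -> (forall j, polyfun (s j)) -> polymx b ->
  polymx (fun u => y u - circle_mx fc (fun j => c j u) (fun j => s j u) *m b u).
Proof.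
by move=> py pc ps pb; exact/(polymxB py)/(polymxM (polymx_circle pc ps)).
Qed.

Lemma polyfun_circle_eta (J : Type) m (y : (J -> R) -> 'cV[R]_n)
    (c s : 'I_m -> (J -> R) -> R) (b : (J -> R) -> 'cV[R]_m) (c' s' : (J -> R) -> R) :
  polymx y -> (forall j, polyfun (c j)) -> (forall j, polyfun (s j)) -> polymx b ->
  polyfun c' -> polyfun s' ->
  polyfun (fun u => circle_eta lam (y u) (fun j => c j u) (fun j => s j u) (b u)
                               (c' u) (s' u)).
Proof.
move=> py pc ps pb pc' ps'; apply: polyfun_sum => i.
have pr := polymx_residual py pc ps pb i 0.
exact: (polyfunM (polyfunM (polyfun_const _) pr) (polyfun_circle_phi i pc' ps')).
Qed.

(** The proof follows the nesting of the definition. Formulas admit arbitrary real coefficients, so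
    [lam^-1], the square root of 2 and the angular frequencies enter as constants. *)
Lemma semialg_circleQ_ex m (sigma : 'cV[R]_m) I ell :
  semialg (circleQ_ex sigma I ell).
Proof.
apply: semialg_exists; apply: semialg_exists => /=.
apply: semialg_exists; apply: semialg_exists => /=.
apply: semialg_and.
  apply: semialg_forall_fin => j; apply: semialg_eq; last exact: polyfun_const.
  by apply: polyfunD; apply: polyfunM; exact: polyfun_var.
apply: semialg_and.
  apply: semialg_forall_fin => j; apply: semialg_and.
    by apply: semialg_le; [exact: polyfun_const|exact: polyfun_var].
  by apply: semialg_eq; apply: polyfunM; exact: polyfun_var.
apply: semialg_and.
  apply: semialg_forall => /=; apply: semialg_imp.
    apply: semialg_eq; last exact: polyfun_const.
    by apply: polyfunD; apply: polyfunM; exact: polyfun_var.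
  apply: semialg_and; apply: semialg_le; try exact: polyfun_const.
    apply: polyfun_circle_eta; try by move=> *; exact: polyfun_var.
    - by apply: polymx_colv => ?; exact: polyfun_var.
    - by apply: polymx_colv => ?; exact: polyfun_var.
  apply: polyfun_circle_eta; try by move=> *; exact: polyfun_var.
  - by apply: polymx_colv => ?; exact: polyfun_var.
  - by apply: polymx_colv => ?; exact: polyfun_var.
apply: semialg_and.
  apply: semialg_eq; last by apply: polyfun_sum => k; exact: polyfun_var.
  apply: polyfun_sum => j; apply: polyfunM; first exact: polyfun_var.
  apply: polyfun_circle_eta; try by move=> *; exact: polyfun_var.
  - by apply: polymx_colv => ?; exact: polyfun_var.
  - by apply: polymx_colv => ?; exact: polyfun_var.
apply: semialg_and.
  apply: semialg_exists => /=; apply: semialg_mxeq; last exact: polymx_const.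
  apply: polymxM; first by apply: polymx_mxv => ?; exact: polyfun_var.
  by apply: polymx_circle => j; exact: polyfun_var.
apply: semialg_and.
  apply: semialg_exists; apply: semialg_exists => /=.
  apply: semialg_and.
    apply: semialg_and; apply: semialg_penrose.
    - by apply: polymx_circle => j; exact: polyfun_var.
    - by apply: polymx_mxv => ?; exact: polyfun_var.
    - by apply: polymx_tr; apply: polymx_circle => j; exact: polyfun_var.
    - by apply: polymx_mxv => ?; exact: polyfun_var.
  apply: semialg_forall_fin => i; apply: semialg_imp;
    first exact: semialg_const.
  apply: semialg_eq; last exact: polyfun_const.
  apply: polymxM; first by apply: polymx_mxv => ?; exact: polyfun_var.
  apply: polymxB; first by apply: polymx_colv => ?; exact: polyfun_var.
  apply: polymxM; last exact: polymx_const.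
  by apply: polymx_mxv => ?; exact: polyfun_var.
apply: semialg_forall_fin => i; apply: semialg_forall_fin => j.
apply: semialg_imp; first exact: semialg_const.
apply: semialg_eq; last exact: polyfun_const.
apply: polyfun_sum => k; apply: polyfunM; last first.
  by apply: polyfun_circle_phi; exact: polyfun_var.
apply: polyfunM; last exact: polyfun_const.
apply: polyfunM; first exact: polyfun_const.
apply: polymx_residual; try by move=> *; exact: polyfun_var.
- by apply: polymx_colv => ?; exact: polyfun_var.
- by apply: polymx_colv => ?; exact: polyfun_var.
Qed.

Lemma small_covers_bd_setQ m (sigma : 'cV[R]_m) (I : {set 'I_m}) (ell : 'I_m -> nat) :
  small_covers (bd [set q.1.1 | q in @setQ R lam fc m sigma I ell]).
Proof.
have -> : [set q.1.1 | q in @setQ R lam fc m sigma I ell] =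
    [set y | circleQ_ex sigma I ell (fun i => y i 0)].
  by apply/seteqP; split => y /setQ_circleQ_ex.
exact/semialg_bd/semialg_circleQ_ex.
Qed.

Definition circleG_ex (S : R -> Prop) (v : 'cV[R]_n) (u : 'I_n -> R) : Prop :=
  exists c s b : 'I_n -> R, (forall j, c j * c j + s j * s j = 1) /\
    ((forall j, S (b j)) /\ colv u - circle_mx fc c s *m colv b = v).

(** The predicate [S] stands for the sign condition on the weights, so that one argument serves both
    [setGpos] and [setGneg]. *)
Lemma small_covers_bd_G (S : R -> Prop) (v : 'cV[R]_n) :
  (forall (J : Type) (f : (J -> R) -> R), polyfun f -> semialg (fun u => S (f u))) ->
  small_covers (bd [set q.1.1 | q in
    [set q : 'cV[R]_n * 'cV[R]_n * ('I_n -> torus R) |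
      (forall i, S (q.1.2 i 0)) /\ q.1.1 - Phi_mx fc q.2 *m q.1.2 = v]]).
Proof.
move=> sS.
have -> : [set q.1.1 | q in
    [set q : 'cV[R]_n * 'cV[R]_n * ('I_n -> torus R) |
      (forall i, S (q.1.2 i 0)) /\ q.1.1 - Phi_mx fc q.2 *m q.1.2 = v]] =
    [set y | circleG_ex S v (fun i => y i 0)]; last first.
  apply: semialg_bd; apply: semialg_exists; apply: semialg_exists => /=.
  apply: semialg_exists; apply: semialg_and => /=.
    apply: semialg_forall_fin => j; apply: semialg_eq;
      last exact: polyfun_const.
    by apply: polyfunD; apply: polyfunM; exact: polyfun_var.
  apply: semialg_and.
    by apply: semialg_forall_fin => j; apply: sS; exact: polyfun_var.
  apply: semialg_mxeq; last exact: polymx_const.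
  apply: polymx_residual; try by move=> *; exact: polyfun_var.
  - by apply: polymx_colv => ?; exact: polyfun_var.
  - by apply: polymx_colv => ?; exact: polyfun_var.
apply/seteqP; split => y.
- move=> [[[y' b] E] /= [Sb yv] <-].
  exists (fun j => cos (2 * pi * repr (E j))), (fun j => sin (2 * pi * repr (E j))).
  exists (fun j => b j 0); rewrite !colvK -circle_mx_Phi.
  rewrite (_ : (fun j => _) = E); last by apply/funext => j; rewrite torus_piK.
  by split => // j; rewrite -!expr2 cos2Dsin2.
- move=> [c [s [b [cs [Sb yv]]]]]; rewrite colvK in yv.
  have /choice[t tP] : forall j, exists t,
      cos (2 * pi * t) = c j /\ sin (2 * pi * t) = s j.
    by move=> j; exact: circle_param.
  exists (y, colv b, (fun j => torus_pi (t j))) => //=; split.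
    by move=> i; rewrite mxE.
  rewrite circle_mx_Phi -[RHS]yv; congr (_ - circle_mx _ _ _ *m _).
    by apply/funext => j; have [] := tP j.
  by apply/funext => j; have [] := tP j.
Qed.

Lemma small_covers_bigcup_count k (T : countType) (A : T -> set 'cV[R]_k.+1) :
  (forall x, small_covers (A x)) -> small_covers (\bigcup_x A x).
Proof.
move=> sA; pose B i := if unpickle i is Some x then A x else set0.
apply: (@small_covers_sub _ _ _ (\bigcup_i B i)).
  by move=> y [x _ Axy]; exists (pickle x) => //; rewrite /B pickleK.
apply: small_covers_bigcup => i; rewrite /B; case: unpickle => // e e0.
exists (fun=> 0), (fun=> 0); split => // N; rewrite big1 ?ltW// => j _.
by rewrite /box_volume big_ord_recl subrr mul0r.
Qed.

Lemma small_covers_setU k (A B : set 'cV[R]_k.+1) :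
  small_covers A -> small_covers B -> small_covers (A `|` B).
Proof.
move=> sA sB.
have sAB (b : bool) : small_covers (if b then A else B) by case: b.
apply: small_covers_sub (small_covers_bigcup_count sAB).
by move=> y [Ay|By]; [exists true|exists false].
Qed.

(** Coding the signs by Booleans, with [true] for -1, and the multiplicities by finite functions
    makes the index type countable for each [m]. *)
Lemma small_covers_setH : small_covers (setH lam fc).
Proof.
pose sgn m (f : {ffun 'I_m -> bool}) : 'cV[R]_m := \col_i (-1) ^+ f i.
pose A m (x : {ffun 'I_m -> bool} * {set 'I_m} * {ffun 'I_m -> nat}) :=
  bd [set q.1.1 | q in @setQ R lam fc m (sgn m x.1.1) x.1.2 x.2].
apply: (@small_covers_sub _ _ _ (\bigcup_m \bigcup_x A m x)); last first.
  apply: small_covers_bigcup => m; apply: small_covers_bigcup_count => x.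
  exact: small_covers_bd_setQ.
move=> y [m _ [[[sigma I] ell] /= [sg _ _] yQ]]; exists m => //.
exists ([ffun i => sigma i 0 == -1], I, [ffun i => ell i]) => //; rewrite /A /=.
rewrite (_ : sgn _ _ = sigma); last first.
  apply/matrixP => i j; rewrite !mxE ffunE ord1.
  have [->|->] := sg i; first by rewrite eqxx expr1.
  by rewrite gt_eqF// (lt_trans (ltrN10 _)).
by have -> : [ffun i => ell i] = ell :> ('I_m -> nat) by apply/funext => i;
  rewrite ffunE.
Qed.

Lemma small_covers_setK : small_covers (setK lam fc).
Proof.
apply: small_covers_setU.
  apply: small_covers_setU; first exact: small_covers_setH.
  apply: (@small_covers_bd_G (fun r => 0 <= r)) => J f pf.
  exact: (semialg_le (polyfun_const _) pf).
apply: (@small_covers_bd_G (fun r => r <= 0)) => J f pf.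
exact: (semialg_le pf (polyfun_const _)).
Qed.
End Boundaries.

Theorem proposition2 (R : realType) (lam : R) (fc : nat)
    (lam_gt0 : 0 < lam) (fc_gt0 : (0 < fc)%N) :
  lebesgue_null (setK lam fc).
Proof. exact/small_covers_null/small_covers_setK. Qed.
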